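(* Let $T$ be Thompson's group acting on the circle $S^1$ in the standard way. Then the groupoid of germs $G(T,S^1)$ of the action of $T$ on $S^1$ is Borel amenable.
   Context: Thompson's group $T$. Thompson's group $V$ consists of the piecewise linear, right continuous bijections of $[0,1)$ which have finitely many points of non-differentiability, all being dyadic rationals, and whose derivative is an integer power of $2$ at each point of differentiability. $T$ is the subgroup of $V$ consisting of elements with at most one point of discontinuity (as maps of $[0,1)$); identifying $[0,1)$ with $S^1$ via $\theta\mapsto e^{2\pi i\theta}$, elements of $T$ are homeomorphisms of $S^1$. Groupoid of germs. Let $\Gamma$ be a group acting on a compact Hausdorff space $X$. For $x\in X$ let $\Gamma_x^0:=\{g\in\Gamma: g\text{ fixes pointwise a neighborhood of }x\}$. Define an equivalence relation on $\Gamma\times X$ by $(g,x)\sim(h,y)$ iff $x=y$ and $g\Gamma_x^0=h\Gamma_x^0$. The groupoid of germs is the set $G(\Gamma,X):=(\Gamma\times X)/\!\sim$, whose elements are written $[g,x]$, with the topology generated by the sets $[g,U]:=\{[g,x]:x\in U\}$ for $g\in\Gamma$ and $U\subset X$ open. Inversion is $[g,x]^{-1}=[g^{-1},gx]$; $[h,y]$ and $[g,x]$ are multipliable iff $y=gx$, in which case $[h,y][g,x]:=[hg,x]$. Identifying the unit space with $X$ via $x\mapsto[e,x]$, the source and range are $s([g,x])=x$ and $r([g,x])=gx$. This is an étale groupoid. Borel amenability. A topological groupoid $G$ is étale if its unit space $G^{(0)}$ is Hausdorff and the range and source maps $r,s\colon G\to G^{(0)}$ are local homeomorphisms ($G$ itself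 need not be Hausdorff). A second countable étale groupoid $G$ is Borel amenable if there exists a sequence $(m_n)_{n\in\mathbb{N}}$, where each $m_n=(m_n^x)_{x\in G^{(0)}}$ is a family with $m_n^x$ a probability measure on the set $r^{-1}(x)$, such that: (i) for all $n\in\mathbb{N}$ and every bounded Borel function $f$ on $G$, the function $x\mapsto\sum_{g\in r^{-1}(x)}f(g)m_n^x(g)$ is Borel on $G^{(0)}$; (ii) for all $g\in G$, $\sum_{h\in r^{-1}(r(g))}|m_n^{s(g)}(g^{-1}h)-m_n^{r(g)}(h)|\to 0$ as $n\to\infty$. *)

(* Defs.v *)
From HB Require Import structures.
From mathcomp Require Import all_boot all_order all_algebra.
From mathcomp Require Import generic_quotient ring lra.
From mathcomp Require Import all_classical all_reals all_analysis.
Set Implicit Arguments.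
Unset Strict Implicit.
Unset Printing Implicit Defensive.
Import Order.TTheory GRing.Theory Num.Theory.
Import numFieldNormedType.Exports.
Local Open Scope classical_set_scope.
Local Open Scope ring_scope.

(* The unit space is kept as a separate space [gobj], embedded by [gid].
   [gmul a b] is total, but meaningful only when [gsrc a = grng b].           *)
Record groupoid := Groupoid {
  garr : topologicalType;
  gobj : topologicalType;
  gsrc : garr -> gobj;
  grng : garr -> gobj;
  gid : gobj -> garr;
  ginv : garr -> garr;
  gmul : garr -> garr -> garr;
  gsrc_id : forall x, gsrc (gid x) = x;
  grng_id : forall x, grng (gid x) = x;
  gsrc_inv : forall a, gsrc (ginv a) = grng a;
  grng_inv : forall a, grng (ginv a) = gsrc a;
  gsrc_mul : forall a b, gsrc a = grng b -> gsrc (gmul a b) = gsrc b;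
  grng_mul : forall a b, gsrc a = grng b -> grng (gmul a b) = grng a;
  gmulA : forall a b c, gsrc a = grng b -> gsrc b = grng c ->
    gmul a (gmul b c) = gmul (gmul a b) c;
  gmul1 : forall a, gmul a (gid (gsrc a)) = a;
  g1mul : forall a, gmul (gid (grng a)) a = a;
  gmulV : forall a, gmul a (ginv a) = gid (grng a);
  gVmul : forall a, gmul (ginv a) a = gid (gsrc a)
}.

Arguments gsrc {g}.
Arguments grng {g}.
Arguments gid {g}.
Arguments ginv {g}.
Arguments gmul {g}.

Definition topological_groupoid (G : groupoid) : Prop :=
  [/\ continuous (@gsrc G), continuous (@grng G), continuous (@gid G),
      continuous (@ginv G) &
      {within [set ab : garr G * garr G | gsrc ab.1 = grng ab.2],
        continuous (fun ab => gmul ab.1 ab.2)}].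

Definition local_homeomorphism (X Y : topologicalType) (f : X -> Y) : Prop :=
  forall x, exists U : set X,
    [/\ open U, U x, set_inj U f, {within U, continuous f} &
        forall V : set X, open V -> V `<=` U -> open (f @` V)].

Definition etale (G : groupoid) : Prop :=
  [/\ topological_groupoid G, hausdorff_space (gobj G),
      local_homeomorphism (@gsrc G) & local_homeomorphism (@grng G)].

Definition borel_function (R : realType) (X : topologicalType) (f : X -> R) :=
  forall B : set R, measurable B -> <<s open >> (f @^-1` B).

(* Sum of an absolutely summable real family indexed by [D]. *)
Definition asum (R : realType) (I : choiceType) (D : set I) (f : I -> R) : R :=
  fine (\esum_(i in D) ((EFin \o f)^\+%E i)) -
  fine (\esum_(i in D) ((EFin \o f)^\-%E i)).

(* [m n x] is (the mass function of) a probability measure on the fibre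
   [grng @^-1` [set x]]; its values off that fibre are irrelevant.            *)
Definition borel_amenable (R : realType) (G : groupoid) : Prop :=
  [/\ @second_countable (garr G), etale G &
  exists m : nat -> gobj G -> garr G -> R,
  [/\ (forall n x g, grng g = x -> 0 <= m n x g),
      (forall n x, \esum_(g in grng @^-1` [set x]) (m n x g)%:E = 1%E),
      (forall n (f : garr G -> R),
        (exists M : R, forall g, `|f g| <= M) -> borel_function f ->
        borel_function
          (fun x => asum (grng @^-1` [set x]) (fun g => f g * m n x g))) &
      (forall g : garr G,
        \esum_(h in grng @^-1` [set grng g])
          (`|m n (gsrc g) (gmul (ginv g) h) - m n (grng g) h|)%:E
          @[n --> \oo] --> 0%E)]].

Record group_action (Gam : groupType) (X : topologicalType) := GroupAction {
  act :> Gam -> X -> X;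
  act1 : forall x, act 1%g x = x;
  actM : forall g h x, act (g * h)%g x = act g (act h x);
  act_continuous : forall g, continuous (act g)
}.

Section Germs.
Local Open Scope quotient_scope.
Variables (Gam : groupType) (X : topologicalType) (a : group_action Gam X).
Implicit Types (g h k : Gam) (x y : X).

Definition germ_stab x : set Gam := [set g | \forall y \near x, a g y = y].

Definition germ_coset (p : Gam * X) : set Gam :=
  [set (p.1 * k)%g | k in germ_stab p.2].

Definition germ_rel (p q : Gam * X) : bool :=
  `[< p.2 = q.2 /\ germ_coset p = germ_coset q >].

Lemma germ_rel_refl : reflexive germ_rel.
Proof. by move=> p; apply/asboolP. Qed.

Lemma germ_rel_sym : symmetric germ_rel.
Proof. by move=> p q; apply/asboolP/asboolP => -[-> ->]. Qed.

Lemma germ_rel_trans : transitive germ_rel.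
Proof. by move=> q p r /asboolP[e1 e2] /asboolP[e3 e4]; apply/asboolP; rewrite e1 e2. Qed.

Canonical germ_equiv :=
  EquivRel germ_rel germ_rel_refl germ_rel_sym germ_rel_trans.

Definition germs := {eq_quot germ_rel}.
HB.instance Definition _ := Choice.on germs.

Definition germ g x : germs := \pi_{eq_quot germ_rel} (g, x).

HB.instance Definition _ := isSubBaseTopological.Build germs
  [set A | exists g (U : set X), open U /\ A = [set germ g x | x in U]] id.

Lemma actVK g : cancel (a g) (a g^-1%g).
Proof. by move=> x; rewrite -actM mulVg act1. Qed.

Lemma actKV g : cancel (a g^-1%g) (a g).
Proof. by move=> x; rewrite -actM mulgV act1. Qed.

Lemma germ_stab_near g h x :
  germ_stab x (g^-1 * h)%g <-> \forall y \near x, a g y = a h y.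
Proof.
split; apply: filterS => y; first by rewrite actM => /(congr1 (a g)); rewrite actKV.
by move=> e; rewrite actM -e actVK.
Qed.

Lemma germ_stab1 x : germ_stab x 1%g.
Proof. by apply: nearW => y; rewrite act1. Qed.

Lemma germ_stabM x g h : germ_stab x g -> germ_stab x h -> germ_stab x (g * h)%g.
Proof. by apply: filterS2 => y gy hy; rewrite actM hy gy. Qed.

Lemma germ_stabV x g : germ_stab x g -> germ_stab x g^-1%g.
Proof. by apply: filterS => y gy; rewrite -{1}gy actVK. Qed.

Lemma germ_eq g h x y :
  germ g x = germ h y <-> x = y /\ \forall z \near x, a g z = a h z.
Proof.
have -> : germ g x = germ h y <-> germ_rel (g, x) (h, y).
  by split => [/eqmodP|e]//; apply/eqmodP.
split => [/asboolP[/= <- e]|[<- /germ_stab_near e]].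
  split=> //; apply/germ_stab_near.
  have : germ_coset (h, x) h by exists 1%g; [exact: germ_stab1|rewrite mulg1].
  by rewrite -e => -[k kx /= <-]; rewrite mulKg.
apply/asboolP; split=> //=; apply/seteqP; split=> _ [k kx /= <-].
  exists (h^-1 * g * k)%g; last by rewrite !mulgA mulgV mul1g.
  by apply: germ_stabM => //; rewrite -[X in germ_stab _ X]invgK invgM invgK; exact: germ_stabV.
exists (g^-1 * h * k)%g; first exact: germ_stabM.
by rewrite !mulgA mulgV mul1g.
Qed.

Definition germ_src (c : germs) : X := (repr c).2.
Definition germ_rng (c : germs) : X := a (repr c).1 (repr c).2.
Definition germ_id (x : X) : germs := germ 1%g x.
Definition germ_inv (c : germs) : germs :=
  germ (repr c).1^-1%g (germ_rng c).
Definition germ_mul (c b : germs) : germs :=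
  germ ((repr c).1 * (repr b).1)%g (germ_src b).

Lemma germ_repr g x : exists2 k, (repr (germ g x)) = (k, x) &
  \forall y \near x, a k y = a g y.
Proof.
have : germ (repr (germ g x)).1 (repr (germ g x)).2 = germ g x.
  by rewrite /germ -surjective_pairing reprK.
by move=> /germ_eq[]; case: repr => k y /= -> ?; exists k.
Qed.

Lemma germP (P : germs -> Prop) : (forall g x, P (germ g x)) -> forall c, P c.
Proof. by move=> h; elim/quotW => -[g x]; exact: h. Qed.

Lemma germ_srcE g x : germ_src (germ g x) = x.
Proof. by rewrite /germ_src; have [k ->] := germ_repr g x. Qed.

Lemma germ_rngE g x : germ_rng (germ g x) = a g x.
Proof. by rewrite /germ_rng; have [k ->/=] := germ_repr g x; exact: nbhs_singleton. Qed.

Lemma near_act g h h' x : (\forall y \near a g x, a h y = a h' y) ->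
  \forall y \near x, a h (a g y) = a h' (a g y).
Proof. by move=> e; exact: (act_continuous (g := g) (x := x) e). Qed.

Lemma germ_invE g x : germ_inv (germ g x) = germ g^-1%g (a g x).
Proof.
rewrite /germ_inv germ_rngE; have [k ->/= e] := germ_repr g x.
apply/germ_eq; split=> //.
have : \forall y \near a g x, a k (a g^-1%g y) = a g (a g^-1%g y).
  by apply: near_act; rewrite actVK.
by apply: filterS => y; rewrite actKV => /(congr1 (a k^-1%g)); rewrite actVK.
Qed.

Lemma germ_mulE h g x : germ_mul (germ h (a g x)) (germ g x) = germ (h * g)%g x.
Proof.
rewrite /germ_mul germ_srcE.
have [k ->/= e] := germ_repr g x; have [l ->/= f] := germ_repr h (a g x).
apply/germ_eq; split=> //; have := near_act f.
by apply: filterS2 e => y ky ly; rewrite !actM ky ly.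
Qed.

Lemma germ_src_id x : germ_src (germ_id x) = x.
Proof. exact: germ_srcE. Qed.

Lemma germ_rng_id x : germ_rng (germ_id x) = x.
Proof. by rewrite germ_rngE act1. Qed.

Lemma germ_src_inv c : germ_src (germ_inv c) = germ_rng c.
Proof. exact: germ_srcE. Qed.

Lemma germ_rng_inv c : germ_rng (germ_inv c) = germ_src c.
Proof. by elim/germP: c => g x; rewrite germ_invE germ_rngE germ_srcE actVK. Qed.

Lemma germ_src_mul c b :
  germ_src c = germ_rng b -> germ_src (germ_mul c b) = germ_src b.
Proof. by rewrite germ_srcE. Qed.

Lemma germ_rng_mul c b :
  germ_src c = germ_rng b -> germ_rng (germ_mul c b) = germ_rng c.
Proof.
elim/germP: c => h y; elim/germP: b => g x.
by rewrite germ_srcE germ_rngE => ->; rewrite germ_mulE !germ_rngE actM.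
Qed.

Lemma germ_mulA c b d : germ_src c = germ_rng b -> germ_src b = germ_rng d ->
  germ_mul c (germ_mul b d) = germ_mul (germ_mul c b) d.
Proof.
elim/germP: c => h y; elim/germP: b => g x; elim/germP: d => k z.
rewrite !germ_srcE !germ_rngE => -> ->.
by rewrite !germ_mulE -(actM a g k) germ_mulE mulgA.
Qed.

Lemma germ_mul1 c : germ_mul c (germ_id (germ_src c)) = c.
Proof.
elim/germP: c => g x; rewrite germ_srcE -{1}(act1 a x).
by rewrite germ_mulE mulg1.
Qed.

Lemma germ_1mul c : germ_mul (germ_id (germ_rng c)) c = c.
Proof. by elim/germP: c => g x; rewrite germ_rngE germ_mulE mul1g. Qed.

Lemma germ_mulV c : germ_mul c (germ_inv c) = germ_id (germ_rng c).
Proof.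
elim/germP: c => g x; rewrite germ_invE germ_rngE -{1}(actVK g x).
by rewrite germ_mulE mulgV.
Qed.

Lemma germ_Vmul c : germ_mul (germ_inv c) c = germ_id (germ_src c).
Proof. by elim/germP: c => g x; rewrite germ_invE germ_srcE germ_mulE mulVg. Qed.

Definition germ_groupoid : groupoid :=
  Groupoid germ_src_id germ_rng_id germ_src_inv germ_rng_inv germ_src_mul
    germ_rng_mul germ_mulA germ_mul1 germ_1mul germ_mulV germ_Vmul.

End Germs.

Section PiecewiseDyadic.
Variable R : realType.
Implicit Types (f h : R -> R) (s : seq R) (t u v w x y z : R) (k : int).

Definition dyadic x : Prop := exists (k : int) (n : nat), x = k%:~R / 2 ^+ n.

Definition piecewise_linear f : Prop :=
  exists s : seq R, forall a b : R, 0 <= a -> b <= 1 ->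
    (forall t, t \in s -> ~ a < t < b) ->
    exists m c : R, forall x, a < x < b -> f x = m * x + c.

Lemma dyadic0 : dyadic 0.
Proof. by exists 0, 0%N; rewrite mul0r. Qed.

Lemma dyadic1 : dyadic 1.
Proof. by exists 1, 0%N; rewrite divr1. Qed.

Lemma dyadicN x : dyadic x -> dyadic (- x).
Proof. by move=> [k [n ->]]; exists (- k), n; rewrite mulrNz mulNr. Qed.

Lemma dyadicD x y : dyadic x -> dyadic y -> dyadic (x + y).
Proof.
move=> [k [n ->]] [l [m ->]]; exists (k * 2 ^+ m + l * 2 ^+ n), (n + m)%N.
have n2 : (2 : R) ^+ n != 0 by rewrite expf_neq0.
have m2 : (2 : R) ^+ m != 0 by rewrite expf_neq0.
by rewrite intrD !intrM !rmorphXn /= exprD; field; rewrite n2 m2.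
Qed.

Lemma dyadicB x y : dyadic x -> dyadic y -> dyadic (x - y).
Proof. by move=> dx dy; apply: dyadicD => //; exact: dyadicN. Qed.

Lemma dyadicM x y : dyadic x -> dyadic y -> dyadic (x * y).
Proof.
move=> [k [n ->]] [l [m ->]]; exists (k * l), (n + m)%N.
have n2 : (2 : R) ^+ n != 0 by rewrite expf_neq0.
have m2 : (2 : R) ^+ m != 0 by rewrite expf_neq0.
by rewrite intrM exprD; field; rewrite n2 m2.
Qed.

Lemma dyadic_pow2 k : dyadic (2 ^ k).
Proof.
case: k => n; first by exists (2 ^+ n), 0%N; rewrite divr1 rmorphXn.
by exists 1, n.+1; rewrite mul1r.
Qed.

Lemma pow2_gt0 k : 0 < (2 : R) ^ k.
Proof. exact: exprz_gt0. Qed.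

Lemma pow2K k : (2 : R) ^ k * 2 ^ (- k) = 1.
Proof. by rewrite -expfzDr ?subrr. Qed.

Lemma pos_below3 x y z : 0 < x -> 0 < y -> 0 < z ->
  exists e, [/\ 0 < e, e < x, e < y & e < z].
Proof.
move=> x0 y0 z0; set m := Num.min x (Num.min y z).
have m0 : 0 < m by rewrite !lt_min x0 y0.
have : m / 2 < m by rewrite ltr_pdivrMr// ltr_pMr// ltr1n.
by rewrite !lt_min => /and3P[? ? ?]; exists (m / 2); rewrite divr_gt0.
Qed.

Definition free s u v := forall t, t \in s -> ~ u < t < v.

Lemma next_break s u : u < 1 -> exists v,
  [/\ u < v <= 1, v \in 1 :: s & free s u v].
Proof.
move=> u1; elim: s => [|t s [v [uv vs fv]]].
  by exists 1; rewrite u1 lexx mem_head; split.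
have [utv|utv] := boolP (u < t < v).
  exists t; split; first by move: utv uv => /andP[-> /ltW h] /andP[_ /(le_trans h)].
    by rewrite !inE eqxx orbT.
  move=> z; rewrite inE => /predU1P[->|zs]; first by rewrite ltxx andbF.
  move=> /andP[uz zt]; apply: (fv z zs); rewrite uz (lt_trans zt)//.
  by case/andP: utv.
exists v; split=> //; first by move: vs; rewrite !inE => /orP[->//|->]; rewrite !orbT.
by move=> z; rewrite inE => /predU1P[->|/fv//]; exact/negP.
Qed.

Lemma prev_break s v : 0 < v -> exists u,
  [/\ 0 <= u < v, u \in 0 :: s & free s u v].
Proof.
move=> v0; elim: s => [|t s [u [uv us fu]]].
  by exists 0; rewrite v0 lexx mem_head; split.
have [utv|utv] := boolP (u < t < v).
  exists t; split.
  - by move: utv uv => /andP[/ltW h ->] /andP[/le_trans/(_ h)-> _].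
  - by rewrite !inE eqxx orbT.
  move=> z; rewrite inE => /predU1P[->|zs]; first by rewrite ltxx.
  move=> /andP[tz zv]; apply: (fu z zs); rewrite zv andbT (lt_trans _ tz)//.
  by case/andP: utv.
exists u; split=> //; first by move: us; rewrite !inE => /orP[->//|->]; rewrite !orbT.
by move=> z; rewrite inE => /predU1P[->|/fu//]; exact/negP.
Qed.

Definition affine_on f u v k c := forall x, u <= x < v -> f x = 2 ^ k * x + c.

Definition piecewise_pow2 f s := forall a b, 0 <= a -> a < b -> b <= 1 ->
  free s a b -> exists k c, affine_on f a b k c.

Definition maps01 f := forall x, 0 <= x < 1 -> 0 <= f x < 1.

Definition inverse01 f h := maps01 f /\ maps01 h /\
  forall x, 0 <= x < 1 -> h (f x) = x /\ f (h x) = x.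

Lemma inverse01_sym f h : inverse01 f h -> inverse01 h f.
Proof. by move=> [? [? fh]]; split=> //; split=> // x /fh[]. Qed.

(* [f] is affine on the left of [v] and tends to [w] there *)
Definition left_lim f v w :=
  exists u k c, [/\ 0 <= u < v, v <= 1, affine_on f u v k c & w = 2 ^ k * v + c].

Section Bijection.
Variables (f h : R -> R) (s : seq R).
Hypotheses (fh : inverse01 f h) (fs : piecewise_pow2 f s).

Let f01 : maps01 f. Proof. by case: fh. Qed.
Let h01 : maps01 h. Proof. by case: fh => _ [fhh _]. Qed.
Let hK x : 0 <= x < 1 -> f (h x) = x. Proof. by case: fh => _ [_ e] /e[]. Qed.
Let fK x : 0 <= x < 1 -> h (f x) = x. Proof. by case: fh => _ [_ e] /e[]. Qed.

Lemma inj01 x y : 0 <= x < 1 -> 0 <= y < 1 -> f x = f y -> x = y.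
Proof. by move=> x01 y01 e; rewrite -(fK x01) e fK. Qed.

Lemma left_lim_bound v w : left_lim f v w -> 0 < w <= 1.
Proof.
move=> [u [k [c [/andP[u0 uv] v1 fuv ->]]]].
have m0 := pow2_gt0 k; rewrite /affine_on in fuv; set m := 2 ^ k in m0 fuv *; clearbody m.
have u01 : 0 <= u < 1 by rewrite u0 (lt_le_trans uv).
apply/andP; split.
  have := f01 u01; rewrite fuv ?lexx// => /andP[fu0 _].
  have mm : m * u < m * v by rewrite ltr_pM2l.
  lra.
rewrite leNgt; apply/negP => w1.
pose x := Num.max u ((1 - c) / m).
have ux : u <= x by rewrite le_max lexx.
have xv : x < v by rewrite gt_max uv ltr_pdivrMr//; lra.
have : 0 <= x < 1 by rewrite (le_trans u0 ux) (lt_le_trans xv).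
move=> /f01 /andP[_]; rewrite fuv ?ux// ltNge => /negP; apply.
have : (1 - c) / m <= x by rewrite le_max lexx orbT.
by rewrite ler_pdivrMr//; lra.
Qed.

Lemma left_lim_inj v1 v2 w : left_lim f v1 w -> left_lim f v2 w -> v1 = v2.
Proof.
move=> [u1 [k1 [c1 [/andP[u10 uv1] v11 f1 w1]]]].
move=> [u2 [k2 [c2 [/andP[u20 uv2] v21 f2 w2]]]].
apply/eqP; rewrite -subr_eq0 -normr_eq0; apply/negPn/negP => v12.
have {}v12 : 0 < `|v1 - v2| by rewrite lt_def v12 normr_ge0.
have p1 := pow2_gt0 k1; have p2 := pow2_gt0 k2.
rewrite /affine_on in f1 f2.
set m1 := 2 ^ k1 in p1 f1 w1; set m2 := 2 ^ k2 in p2 f2 w2; clearbody m1 m2.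
have [e [e0 e3 e1 e2]] : exists e, [/\ 0 < e, e < `|v1 - v2|, e < v1 - u1 & e < v2 - u2].
  by apply: pos_below3; rewrite ?subr_gt0.
pose d := Num.min (m1 * e) (m2 * e).
have d0 : 0 < d by rewrite lt_min !mulr_gt0.
have d1 : d / m1 <= e by rewrite ler_pdivrMr// mulrC ge_min lexx.
have d2 : d / m2 <= e by rewrite ler_pdivrMr// mulrC ge_min lexx orbT.
have q1 : 0 < d / m1 by rewrite divr_gt0.
have q2 : 0 < d / m2 by rewrite divr_gt0.
have x12 : v1 - d / m1 = v2 - d / m2.
  apply: inj01; [lra|lra|].
  rewrite f1; last lra.
  rewrite f2; last lra.
  have -> : m1 * (v1 - d / m1) + c1 = m1 * v1 + c1 - d by field; rewrite gt_eqF.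
  have -> : m2 * (v2 - d / m2) + c2 = m2 * v2 + c2 - d by field; rewrite gt_eqF.
  by rewrite -w1 -w2.
by move: e3; case: (ler0P (v1 - v2)) => _; lra.
Qed.

Lemma piece_around p : 0 < p < 1 -> p \notin s -> exists u v k c,
  [/\ 0 <= u < p, p < v <= 1, u \in 0 :: s & affine_on f u v k c].
Proof.
move=> /andP[p0 p1] ps.
have [u [/andP[u0 up] us fu]] := prev_break s p0.
have [v [/andP[pv v1] _ fv]] := next_break s p1.
have fuv : free s u v.
  move=> t ts /andP[ut tv]; have [tp|tp|tp] := ltgtP t p.
  - by apply: (fu t ts); rewrite ut.
  - by apply: (fv t ts); rewrite tp.
  - by move: ps; rewrite -tp ts.
have [k [c fkc]] := fs u0 (lt_trans up pv) v1 fuv.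
by exists u, v, k, c; rewrite u0 up pv.
Qed.

Lemma left_lim_ex v : 0 < v <= 1 -> exists w, left_lim f v w.
Proof.
move=> /andP[v0 v1]; have [u [/andP[u0 uv] _ fu]] := prev_break s v0.
have [k [c fkc]] := fs u0 uv v1 fu.
by exists (2 ^ k * v + c), u, k, c; rewrite u0 uv.
Qed.

Lemma left_lim_nobreak p : 0 < p < 1 -> p \notin s -> left_lim f p (f p).
Proof.
move=> p01 ps; have [u [v [k [c [up /andP[pv v1] _ fuv]]]]] := piece_around p01 ps.
case/andP: (up) => u0 up'.
exists u, k, c; split=> //; first by case/andP: p01 => _ /ltW.
  by move=> x /andP[ux xp]; rewrite fuv// ux (lt_trans xp).
by rewrite fuv// pv ltW.
Qed.

Lemma left_lim_break v p : left_lim f v (f p) -> 0 <= p < 1 -> v \in 1 :: s ->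
  p \in 0 :: s.
Proof.
move=> lv /andP[p0 p1] vs; rewrite inE; apply/orP.
have [->|pn0] := eqVneq p 0; [by left|right].
apply/negPn/negP => ps.
have p01 : 0 < p < 1 by rewrite lt_def pn0 p0.
have pv := left_lim_inj (left_lim_nobreak p01 ps) lv.
move: vs; rewrite -pv inE (negbTE ps) orbF => /eqP p1'.
by rewrite p1' ltxx in p1.
Qed.

Definition breaks := [seq f t | t <- 0 :: s & 0 <= t < 1].

Lemma breaks_mem p : 0 <= p < 1 -> p \in 0 :: s -> f p \in breaks.
Proof. by move=> p01 ps; apply: map_f; rewrite mem_filter p01. Qed.

Lemma piece_inv a b k c u v : 0 <= u -> v <= 1 -> affine_on f u v k c ->
  f u <= a -> b <= 2 ^ k * v + c -> u < v ->
  affine_on h a b (- k) (- c * 2 ^ (- k)).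
Proof.
move=> u0 v1 fuv ua bw uv y /andP[ay yb].
have m0 := pow2_gt0 k; have mK := pow2K k.
rewrite /affine_on in fuv *; set m := 2 ^ k in m0 fuv bw mK *; set m' := 2 ^ (- k) in mK *.
have m'0 : 0 < m' by exact: pow2_gt0.
have -> : m' * y + - c * m' = m' * (y - c) by ring.
set x := m' * (y - c).
have mx : m * x = y - c by rewrite /x mulrA mK mul1r.
have ux : u <= x.
  by rewrite -(ler_pM2l m0) mx; move: ua; rewrite fuv ?lexx// => ua; lra.
have xv : x < v by rewrite -(ltr_pM2l m0) mx; lra.
rewrite -[RHS]fK; last by rewrite (le_trans u0 ux) (lt_le_trans xv).
by rewrite fuv ?ux// mx subrK.
Qed.

Lemma piecewise_pow2_inv : piecewise_pow2 h breaks.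
Proof.
move=> a b a0 ab b1 fB.
have a01 : 0 <= a < 1 by rewrite a0 (lt_le_trans ab).
have /andP[u0 u1] := h01 a01; have fu := hK a01; set u := h a in u0 u1 fu.
have [v [/andP[uv v1] vs fuv]] := next_break s u1.
have [k [c fkc]] := fs u0 uv v1 fuv.
exists (- k), (- c * 2 ^ (- k)); apply: (piece_inv u0 v1 fkc) => //.
  by rewrite fu.
rewrite leNgt; apply/negP => wb; set w := 2 ^ k * v + c in wb.
have lw : left_lim f v w by exists u, k, c; rewrite u0 uv.
have /andP[w0 w1] := left_lim_bound lw.
have w01 : 0 <= w < 1 by rewrite ltW//= (lt_le_trans wb).
apply: (fB w); last first.
  rewrite wb andbT -fu fkc ?lexx// /w.
  by rewrite ltrD2r ltr_pM2l// pow2_gt0.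
rewrite -(hK w01); apply: breaks_mem; first exact: h01.
by apply: (@left_lim_break v); rewrite ?hK//; exact: h01.
Qed.

Section Dyadic.
Hypothesis ds : forall t, t \in s -> dyadic t.

Let ds0 t : t \in 0 :: s -> dyadic t.
Proof. by rewrite inE => /predU1P[->|/ds//]; exact: dyadic0. Qed.

Let ds1 t : t \in 1 :: s -> dyadic t.
Proof. by rewrite inE => /predU1P[->|/ds//]; exact: dyadic1. Qed.

Lemma dyadic_break p : 0 <= p < 1 -> p \in 0 :: s -> dyadic (f p).
Proof.
have [n] := ubnP (size [seq b <- breaks | b < f p]).
elim: n p => // n IHn p; rewrite ltnS => szp p01 ps.
have /andP[fp0 fp1] := f01 p01.
have [->|fpn0] := eqVneq (f p) 0; first exact: dyadic0.
have {}fp0 : 0 < f p by rewrite lt_def fpn0.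
have [b [/andP[b0 bfp] bB fb]] := prev_break breaks fp0.
have b01 : 0 <= b < 1 by rewrite b0 (lt_trans bfp).
have q01 := h01 b01; have fq := hK b01; set q := h b in q01 fq.
have qs : q \in 0 :: s.
  move: bB; rewrite inE => /predU1P[b00|/mapP[q' ]].
    apply/negPn/negP; rewrite inE negb_or => /andP[qn0 qs].
    have q01' : 0 < q < 1 by rewrite lt_def qn0.
    have := left_lim_bound (left_lim_nobreak q01' qs).
    by rewrite fq b00 ltxx.
  rewrite mem_filter => /andP[q'01 q's] bq'.
  by rewrite (inj01 q01 q'01)// fq.
have {}bB : b \in breaks by rewrite -fq breaks_mem.
have /andP[q0 q1] := q01.
have [v [/andP[qv v1] vs fqv]] := next_break s q1.
have [k [c fkc]] := fs q0 qv v1 fqv.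
have db : dyadic b.
  rewrite -fq; apply: IHn => //; rewrite fq; apply: leq_trans szp.
  have -> : [seq x <- breaks | x < b] =
            [seq x <- [seq x <- breaks | x < f p] | x < b].
    by rewrite -filter_predI; apply: eq_filter => x /=; case: ltP => //= /lt_trans->.
  rewrite size_filter -(count_predC (fun x => x < b) [seq x <- breaks | x < f p]).
  rewrite -[X in (X < _)%N]addn0 ltn_add2l -has_count; apply/hasP; exists b.
    by rewrite mem_filter bfp.
  by rewrite /= ltxx.
set w := 2 ^ k * v + c.
have lw : left_lim f v w by exists q, k, c; rewrite q0 qv.
have bw : b < w by rewrite -fq fkc ?lexx// ltrD2r ltr_pM2l// pow2_gt0.
have fpw : f p = w.
  apply/eqP; rewrite eq_le; apply/andP; split; rewrite leNgt; apply/negP => lt.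
    have w01 : 0 <= w < 1 by rewrite (le_trans b0 (ltW bw)) (lt_trans lt).
    apply: (fb w); last by rewrite bw.
    rewrite -(hK w01); apply: breaks_mem; first exact: h01.
    by apply: (@left_lim_break v); rewrite ?hK//; exact: h01.
  have := @piece_inv b w k c q v q0 v1 fkc; rewrite fq => /(_ (lexx _) (lexx _) qv).
  move=> /(_ (f p)); rewrite (ltW bfp) lt => /(_ isT); rewrite fK// => pe.
  have m0 := pow2_gt0 k; have mK := pow2K k.
  have {}pe : 2 ^ k * p + c = f p.
    have {}pe : p = 2 ^ (- k) * (f p - c) by rewrite [LHS]pe; ring.
    by rewrite {1}pe mulrA mK mul1r subrK.
  have qp : q < p.
    by rewrite -(ltr_pM2l m0) -(ltrD2r c) pe -fkc ?lexx// fq.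
  have pv : p < v by rewrite -(ltr_pM2l m0) -(ltrD2r c) pe.
  move: ps; rewrite inE => /predU1P[p00|ps].
    by move: qp; rewrite p00 ltNge q0.
  by apply: (fqv p) => //; rewrite qp.
rewrite fpw.
have -> : w = 2 ^ k * (v - q) + b by rewrite -fq fkc ?lexx// /w; ring.
apply: dyadicD => //; apply: dyadicM; first exact: dyadic_pow2.
by apply: dyadicB; [exact: ds1|exact: ds0].
Qed.

Lemma dyadic_piece p : 0 <= p < 1 -> dyadic p <-> dyadic (f p).
Proof.
move=> p01; have [ps|ps] := boolP (p \in 0 :: s).
  by split=> _; [exact: dyadic_break|exact: ds0].
have [pn0 ps'] : p != 0 /\ p \notin s.
  by move: ps; rewrite inE negb_or => /andP[].
have p01' : 0 < p < 1 by rewrite lt_def pn0.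
have [u [v [k [c [/andP[u0 up] /andP[pv v1] us fuv]]]]] := piece_around p01' ps'.
have dfu : dyadic (f u).
  by apply: dyadic_break => //; rewrite u0 (lt_trans up)//; case/andP: p01'.
have e : f p = 2 ^ k * (p - u) + f u.
  rewrite !fuv ?lexx ?(lt_trans up)// ?(ltW up)//; ring.
split=> [dp|dfp].
  rewrite e; apply: dyadicD => //; apply: dyadicM; first exact: dyadic_pow2.
  by apply: dyadicB => //; exact: ds0.
have -> : p = 2 ^ (- k) * (f p - f u) + u.
  by rewrite e addrK mulrA [2 ^ (- k) * _]mulrC pow2K mul1r subrK.
apply: dyadicD; last exact: ds0.
by apply: dyadicM; [exact: dyadic_pow2|exact: dyadicB].
Qed.
End Dyadic.
End Bijection.
End PiecewiseDyadic.

Section Continuity01.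
Variable R : realType.
Implicit Types (f h : R -> R) (s : seq R) (t u v w x y z : R) (k : int).

Definition continuous01 f x : Prop := f t @[t --> within `[0, 1[ (nbhs x)] --> f x.

Lemma continuous01P f x : continuous01 f x <->
  forall e, 0 < e -> exists2 d, 0 < d &
    forall y, 0 <= y < 1 -> `|y - x| < d -> `|f y - f x| < e.
Proof.
split=> [/cvgrPdist_lt fx e /fx|fx].
  rewrite near_withinE => -[d /= d0 dP]; exists d => // y y01 yx.
  by rewrite distrC; apply: dP; rewrite /= ?in_itv//= distrC.
apply/cvgrPdist_lt => e /fx[d d0 dP]; rewrite near_withinE; exists d => //= y yx.
by rewrite in_itv/= => y01; rewrite distrC; apply: dP => //; rewrite distrC.
Qed.

Lemma piecewise_pow2_comp f1 h1 s1 f2 s2 :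
  inverse01 f1 h1 -> piecewise_pow2 f1 s1 -> piecewise_pow2 f2 s2 ->
  piecewise_pow2 (f2 \o f1) (s1 ++ [seq h1 t | t <- s2 & 0 <= t < 1]).
Proof.
move=> fh fs1 fs2 a b a0 ab b1 fr.
have [k1 [c1 f1E]] : exists k c, affine_on f1 a b k c.
  by apply: fs1 => // t ts; apply: fr; rewrite mem_cat ts.
have [f01 [h01 fK]] := fh.
have ll : left_lim f1 b (2 ^ k1 * b + c1) by exists a, k1, c1; rewrite a0 ab.
have /andP[b'0 b'1] := left_lim_bound fh ll.
have a01 : 0 <= a < 1 by rewrite a0 (lt_le_trans ab).
have /andP[a'0 a'1] := f01 _ a01.
have f1a : f1 a = 2 ^ k1 * a + c1 by rewrite f1E ?lexx.
have m0 := pow2_gt0 R k1.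
have a'b' : f1 a < 2 ^ k1 * b + c1 by rewrite f1a ltrD2r ltr_pM2l.
have fr2 : free s2 (f1 a) (2 ^ k1 * b + c1).
  move=> t ts /andP[at' tb].
  have t01 : 0 <= t < 1 by rewrite ltW ?(le_lt_trans a'0)//= (lt_le_trans tb).
  pose x := (t - c1) / 2 ^ k1.
  have mx : 2 ^ k1 * x + c1 = t by rewrite /x mulrCA mulfV ?gt_eqF// mulr1 subrK.
  have ax : a < x by rewrite -(ltr_pM2l m0) -(ltrD2r c1) mx -f1a.
  have xb : x < b by rewrite -(ltr_pM2l m0) -(ltrD2r c1) mx.
  have x01 : 0 <= x < 1 by rewrite (le_trans a0 (ltW ax)) (lt_le_trans xb).
  apply: (fr x); last by rewrite ax.
  rewrite mem_cat; apply/orP; right; apply/mapP; exists t.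
    by rewrite mem_filter t01.
  by rewrite -mx -f1E ?(ltW ax)//; have [-> _] := fK _ x01.
have [k2 [c2 f2E]] := fs2 _ _ a'0 a'b' b'1 fr2.
exists (k2 + k1), (2 ^ k2 * c1 + c2) => x axb /=.
rewrite f2E; last first.
  move: (axb) => /andP[ax xb]; rewrite (f1E x axb) f1a.
  by rewrite lerD2r ltrD2r ler_pM2l// ltr_pM2l// ax xb.
by rewrite f1E// expfzDr//; ring.
Qed.

Lemma piecewise_right f s x : piecewise_pow2 f s -> 0 <= x < 1 ->
  exists v k c, [/\ x < v, v <= 1 & affine_on f x v k c].
Proof.
move=> fs /andP[x0 x1].
have [v [/andP[xv v1] _ fv]] := next_break s x1.
by have [k [c fE]] := fs _ _ x0 xv v1 fv; exists v, k, c.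
Qed.

Lemma affine_right f x v k c : x < v -> affine_on f x v k c ->
  forall e, 0 < e -> exists2 d, 0 < d &
    forall y, x <= y -> y < x + d -> f x <= f y < f x + e.
Proof.
move=> xv fE e e0; have m0 := pow2_gt0 R k; rewrite /affine_on in fE.
move: (2 ^ k) m0 fE => m m0 fE.
have em0 : 0 < e / m by rewrite divr_gt0.
exists (Num.min (v - x) (e / m)); first by rewrite lt_min subr_gt0 xv.
move=> y xy; rewrite -ltrBlDl lt_min => /andP[yv].
rewrite ltr_pdivlMr// => ye.
have xyv : x <= y < v by rewrite xy /=; lra.
rewrite !fE ?lexx//; apply/andP; split; last lra.
by rewrite lerD2r ler_pM2l.
Qed.

Lemma affine_left f v w : left_lim f v w ->
  forall e, 0 < e -> exists2 d, 0 < d &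
    forall y, v - d < y -> y < v -> w - e < f y < w.
Proof.
move=> [u [k [c [/andP[u0 uv] v1 fE ->]]]] e e0; have m0 := pow2_gt0 R k.
rewrite /affine_on in fE; move: (2 ^ k) m0 fE => m m0 fE.
have em0 : 0 < e / m by rewrite divr_gt0.
exists (Num.min (v - u) (e / m)); first by rewrite lt_min subr_gt0 uv.
move=> y; rewrite ltrBlDl -ltrBlDr lt_min => /andP[yv].
rewrite ltr_pdivlMr// => ye xv.
rewrite fE; last by apply/andP; split => //; lra.
have : m * y < m * v by rewrite ltr_pM2l.
by move=> ?; apply/andP; split; lra.
Qed.

Lemma continuous01_piecewise f s x : piecewise_pow2 f s -> 0 <= x < 1 ->
  (0 < x -> left_lim f x (f x)) -> continuous01 f x.
Proof.
move=> fs x01 fl; apply/continuous01P => e e0.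
have [v [k [c [xv _ fE]]]] := piecewise_right fs x01.
have [d1 d10 d1P] := affine_right xv fE e0.
have [d2 d20 d2P] : exists2 d, 0 < d &
    forall y, 0 <= y -> x - d < y -> y < x -> f x - e < f y < f x.
  have [x0|x0|x0] := ltgtP 0 x.
  - by have [d d0 dP] := affine_left (fl x0) e0; exists d => // y _; exact: dP.
  - by move: x01; rewrite leNgt x0.
  - by exists 1 => // y y0 _; rewrite -x0 ltNge y0.
exists (Num.min d1 d2); first by rewrite lt_min d10.
move=> y /andP[y0 y1]; rewrite lt_min !ltr_distl => /andP[/andP[y1x yd1] /andP[y2x yd2]].
have [xy|yx] := leP x y.
  by have /andP[? ?] := d1P y xy yd1; apply/andP; split; lra.
by have /andP[? ?] := d2P y y0 y2x yx; apply/andP; split; lra.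
Qed.

Lemma left_lim_continuous01 f p w : continuous01 f p -> left_lim f p w -> w = f p.
Proof.
move=> /continuous01P fp ll; apply/eqP; rewrite -subr_eq0 -normr_eq0.
apply/negPn/negP => wn; have {}wn : 0 < `|w - f p| by rewrite lt_def wn normr_ge0.
have [u [k [c [/andP[u0 up] p1 _ _]]]] := ll.
pose e := `|w - f p| / 2; have e0 : 0 < e by rewrite divr_gt0.
have [d1 d10 d1P] := fp e e0; have [d2 d20 d2P] := affine_left ll e0.
have [d [d0 dd1 dd2 dpu]] : exists d, [/\ 0 < d, d < d1, d < d2 & d < p - u].
  by apply: pos_below3 => //; rewrite subr_gt0.
have yp : p - d < p by lra.
have y01 : 0 <= p - d < 1 by apply/andP; split; lra.
have /andP[h1 h2] := d2P (p - d) ltac:(lra) yp.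
have : `|p - d - p| < d1 by rewrite addrAC subrr add0r normrN gtr0_norm.
move=> /(d1P _ y01); rewrite ltr_distl => /andP[h3 h4].
by rewrite /e in h1 h3 h4; move: h1 h3 h4; case: ler0P => *; lra.
Qed.

Definition wrap y : R := if y == 0 then 1 else y.

Lemma wrap_inj x y : 0 <= x < 1 -> 0 <= y < 1 -> wrap x = wrap y -> x = y.
Proof.
rewrite /wrap => /andP[_ x1] /andP[_ y1].
case: eqP => [->|_]; case: eqP => [->//|_] e //.
  by rewrite -e ltxx in y1.
by rewrite e ltxx in x1.
Qed.

Section Rotation.
Variables (f h : R -> R) (s : seq R).
Hypotheses (fh : inverse01 f h) (fs : piecewise_pow2 f s).
Hypothesis disc1 : forall x y, 0 <= x < 1 -> 0 <= y < 1 ->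
  ~ continuous01 f x -> ~ continuous01 f y -> x = y.

Let f01 : maps01 f. Proof. by case: fh. Qed.
Let h01 : maps01 h. Proof. by case: fh => _ [fhh _]. Qed.
Let hK x : 0 <= x < 1 -> f (h x) = x. Proof. by case: fh => _ [_ e] /e[]. Qed.

Lemma wrap_no_swap v w : v < 1 -> left_lim f v w -> w = wrap (f 0) ->
  ~ continuous01 f v -> False.
Proof.
move=> v1 ll wE dv.
have [u [k [c [/andP[u0 uv] _ fE wE']]]] := ll.
have z01 : (0 : R) <= (0 : R) < 1 by rewrite lexx ltr01.
have v01 : 0 <= v < 1 by rewrite (le_trans u0 (ltW uv)).
have fc x : 0 <= x < 1 -> x != v -> continuous01 f x.
  move=> x01 xv; apply: contrapT => dx; case/eqP: xv; exact: disc1.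
have fw a b : 0 <= a -> b < v -> {within `[a, b], continuous f}.
  move=> a0 bv; apply/subspace_continuousP => x /=; rewrite in_itv/= => /andP[ax xb].
  have xv : x < v by exact: le_lt_trans bv.
  have : continuous01 f x by apply: fc; [lra|rewrite lt_eqF].
  apply: cvg_trans; apply: cvg_app; apply: within_subset => y /=.
  by rewrite !in_itv/= => /andP[ay yb]; lra.
have [f00|f00] := eqVneq (f 0) 0.
  have w1 : w = 1 by rewrite wE /wrap f00 eqxx.
  have /andP[fv0 fv1] := f01 v01.
  have [d d0 dP] := affine_left ll (ltac:(lra) : 0 < w - f v).
  have [e [e0 ed eu _]] : exists e, [/\ 0 < e, e < d, e < v - u & e < v - u].
    by apply: pos_below3; lra.
  have /andP[fx1 fx2] := dP (v - e) ltac:(lra) ltac:(lra).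
  have [z] : exists2 z, z \in `[0, v - e] & f z = f v.
    apply: IVT; [lra|apply: fw; lra|].
    by rewrite f00 ge_min le_max fv0 /=; apply/orP; right; lra.
  rewrite in_itv/= => /andP[z0 zv] fzv.
  have : z = v by apply: (inj01 fh) => //; lra.
  lra.
have wf0 : w = f 0 by rewrite wE /wrap (negbTE f00).
have [v0 [k0 [c0 [v00 _ f0E]]]] := piecewise_right fs z01.
have [d1 d10 d1P] := affine_right v00 f0E ltr01.
have [d d0 dP] := affine_left ll ltr01.
have [e [e0 ed1 ev0 ev]] : exists e, [/\ 0 < e, e < d1, e < v0 & e < v / 2].
  by apply: pos_below3 => //; lra.
have [e' [e'0 e'd e'v _]] : exists e, [/\ 0 < e, e < d, e < v / 2 & e < v / 2].
  by apply: pos_below3 => //; lra.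
have /andP[fx21 fx22] := dP (v - e') ltac:(lra) ltac:(lra).
have /andP[fx11 fx12] := d1P e ltac:(lra) ltac:(lra).
have [z] : exists2 z, z \in `[e, v - e'] & f z = f 0.
  apply: IVT; [lra|apply: fw; lra|].
  by rewrite ge_min le_max; apply/andP; split; apply/orP; [right|left]; lra.
rewrite in_itv/= => /andP[z0 zv] fz0.
have : z = 0 by apply: (inj01 fh) => //; lra.
lra.
Qed.

Let wind v := if v == 1 then 0 else v.

Let left_lim_target v w : left_lim f v w ->
  exists q, [/\ 0 < q <= 1, w = wrap (f (wind q)) &
    q != v -> q < 1 -> ~ continuous01 f q].
Proof.
move=> ll; have /andP[w0 w1] := left_lim_bound fh ll.
have [q [q01 wq]] : exists q : R, 0 <= q < 1 /\ w = wrap (f q).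
  move: w1; rewrite le_eqVlt => /predU1P[w1|w1].
    exists (h 0); rewrite hK ?lexx ?ltr01// /wrap eqxx; split=> //.
    by apply: h01; rewrite lexx ltr01.
  have w01 : 0 <= w < 1 by rewrite ltW.
  by exists (h w); rewrite hK// /wrap gt_eqF//; split=> //; exact: h01.
have [q' [q'01 q'q]] : exists q', 0 < q' <= 1 /\ wind q' = q.
  have [q0|q0] := eqVneq q 0.
    by exists 1; rewrite ltr01 lexx /wind eqxx.
  exists q; rewrite /wind; move: q01 => /andP[q00 q1].
  by rewrite (lt_eqF q1) (ltW q1) lt_def q0 q00.
exists q'; rewrite q'q; split=> // q'v q'1 cq.
have [w' ll'] := left_lim_ex fs q'01.
have w'E := left_lim_continuous01 cq ll'.
have /andP[w'0 _] := left_lim_bound fh ll'.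
case/eqP: q'v; apply: (left_lim_inj fh ll').
rewrite w'E; move: ll; rewrite wq -q'q /wind lt_eqF// /wrap gt_eqF//.
by rewrite -w'E.
Qed.

Lemma left_lim_wrap v w : left_lim f v w -> w = wrap (f (wind v)).
Proof.
move=> ll; have [q [q01 wq qd]] := left_lim_target ll.
have [qv|qv] := eqVneq q v; first by rewrite wq qv.
have [u [k [c [/andP[u0 uv] v1' _ _]]]] := ll.
have v0 : 0 < v by exact: le_lt_trans uv.
have w01 x : 0 < x -> x <= 1 -> 0 <= f (wind x) < 1.
  move=> x0 x1; apply: f01; rewrite /wind; case: eqP => [_|/eqP xn].
    by rewrite lexx ltr01.
  by rewrite ltW// lt_neqAle xn.
have dv : v < 1 -> ~ continuous01 f v.
  move=> v1 cv; have := left_lim_continuous01 cv ll => wv.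
  have /andP[w0 _] := left_lim_bound fh ll.
  have wv' : w = wrap (f v) by rewrite /wrap gt_eqF// -wv.
  case/eqP: qv; case/andP: q01 => q0 q1.
  have e : f (wind q) = f v.
    by apply: wrap_inj; rewrite -?wq// ?w01//; apply: f01; rewrite ltW.
  have {}e : wind q = v.
    apply: (inj01 fh) => //; last by rewrite ltW.
    rewrite /wind; case: eqP => [_|/eqP xn]; first by rewrite lexx ltr01.
    by rewrite ltW// lt_neqAle xn.
  by move: e v0; rewrite /wind; case: eqP => // _ <-; rewrite ltxx.
have [q1|q1] := eqVneq q 1.
  have v1 : v < 1 by rewrite lt_neqAle -q1 eq_sym qv q1.
  case: (wrap_no_swap v1 ll _ (dv v1)).
  by rewrite wq q1 /wind eqxx.
have {}q1 : q < 1 by rewrite lt_neqAle q1; case/andP: q01.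
have dq := qd qv q1.
have q01' : 0 <= q < 1 by case/andP: q01 => /ltW-> _.
have {}v1' : v = 1.
  apply/eqP/negPn/negP => vn; have v1 : v < 1 by rewrite lt_neqAle vn.
  by case/eqP: qv; apply: disc1 => //; [rewrite ltW|exact: dv].
have [w' ll'] := left_lim_ex fs q01.
have [r [r01 w'r rd]] := left_lim_target ll'.
have [rq|rq] := eqVneq r q.
  by case/eqP: qv; apply: (left_lim_inj fh ll'); rewrite w'r rq -wq.
have r1 : r = 1.
  apply/eqP/negPn/negP => rn.
  have r1 : r < 1 by rewrite lt_neqAle rn; case/andP: r01.
  have dr := rd rq r1; case/eqP: rq; apply: disc1 => //.
  by rewrite r1 andbT ltW//; case/andP: r01.
case: (wrap_no_swap q1 ll' _ dq).
by rewrite w'r r1 /wind eqxx.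
Qed.

Lemma disc_inv y : 0 <= y < 1 -> ~ continuous01 h y -> y = f 0.
Proof.
move=> y01 dy; apply: contrapT => yf; apply: dy.
apply: (continuous01_piecewise (piecewise_pow2_inv fh fs)) => // y0.
have /andP[x0 x1] := h01 y01; have fx := hK y01; set x := h y in x0 x1 fx *.
have {}x0 : 0 < x.
  by rewrite lt_def x0 andbT; apply/eqP => x00; apply: yf; rewrite -fx x00.
have [w ll] := left_lim_ex fs (ltac:(rewrite x0 ltW//) : 0 < x <= 1).
have wy : w = y.
  by rewrite (left_lim_wrap ll) /wind lt_eqF// fx /wrap gt_eqF.
have [u [k [c [/andP[u0 ux] _ fE wE]]]] := ll.
exists (f u), (- k), (- c * 2 ^ (- k)).
have u01 : 0 <= u < 1 by rewrite u0 (lt_trans ux).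
split.
- have /andP[-> _] := f01 u01; rewrite -wy wE fE ?lexx//.
  by rewrite ltrD2r ltr_pM2l// pow2_gt0.
- by case/andP: y01 => _ /ltW.
- by apply: (piece_inv fh u0 (ltW x1) fE) => //; rewrite -wE wy.
- rewrite -wy wE; transitivity ((2 ^ k * 2 ^ (- k)) * x); last by ring.
  by rewrite pow2K mul1r.
Qed.

End Rotation.
End Continuity01.

Section Derivative.
Variable R : realType.
Implicit Types (f : R -> R) (s : seq R) (t u v w x y z : R) (k : int).

Lemma derivable_eps f x : derivable f x 1 -> forall e, 0 < e ->
  exists2 d, 0 < d & forall h : R, h != 0 -> `|h| < d ->
    `|(f (x + h) - f x) / h - derive1 f x| < e.
Proof.
move=> fd e e0; rewrite derive1E.
have /cvgrPdist_lt/(_ e e0) :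
  (fun h : R => h^-1 *: (f (h *: 1 + x) - f x)) @ 0^' --> 'D_1 f x by exact: fd.
rewrite near_withinE => -[d /= d0 dP]; exists d => // h h0 hd.
rewrite distrC mulrC; have := dP h; rewrite /= sub0r normrN => /(_ hd h0).
by rewrite [h *: 1]mulr1 [h + x]addrC.
Qed.

Lemma one_sided_slope f x a m c r : derivable f x 1 -> `|a| = 1 -> 0 < r ->
  (forall h, 0 < h -> h < r -> f (x + a * h) = m * (x + a * h) + c) ->
  f x = m * x + c /\ derive1 f x = m.
Proof.
move=> fd a1 r0 fE; set D := derive1 f x.
have a0 : a != 0 by rewrite -normr_gt0 a1.
pose b := (m * x + c - f x) / a.
have H e : 0 < e -> exists2 d, 0 < d & forall h, 0 < h -> h < d -> `|m + b / h - D| < e.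
  move=> /(derivable_eps fd)[d d0 dP].
  exists (Num.min d r); first by rewrite lt_min d0.
  move=> h h0; rewrite lt_min => /andP[hd hr].
  have ah0 : a * h != 0 by rewrite mulf_neq0// gt_eqF.
  have := dP (a * h) ah0; rewrite normrM a1 mul1r gtr0_norm// => /(_ hd).
  rewrite fE// -/D; congr (`|_ - D| < e).
  by rewrite /b; field; rewrite a0 gt_eqF.
have H2 e : 0 < e -> exists2 d, 0 < d & forall h, 0 < h -> h < d ->
    `|b / h| < e /\ `|m - D| < e.
  move=> e0; have [d d0 dP] := H (e / 4) ltac:(rewrite divr_gt0//).
  exists d => // h h0 hd.
  have := dP h h0 hd; have := dP (h / 2) ltac:(lra) ltac:(lra).
  have -> : b / (h / 2) = 2 * (b / h) by field; rewrite gt_eqF.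
  move: (b / h) => q; rewrite !ltr_distl => /andP[? ?] /andP[? ?].
  split; first by rewrite ltr_norml; apply/andP; split; lra.
  by apply/andP; split; lra.
have mD : m = D.
  apply/eqP; rewrite -subr_eq0 -normr_le0 leNgt; apply/negP => /H2[d d0 dP].
  by have [_] := dP (d / 2) ltac:(lra) ltac:(lra); rewrite ltxx.
have b0 : b = 0.
  apply/eqP; rewrite -normr_le0 leNgt; apply/negP => b0.
  have [d d0 dP] := H2 1 ltr01.
  have [h [h0 hd hb _]] : exists h, [/\ 0 < h, h < d, h < `|b| & h < `|b|].
    by apply: pos_below3.
  have [+ _] := dP h h0 hd; rewrite normf_div (gtr0_norm h0) ltr_pdivrMr// mul1r.
  by move=> /(lt_trans hb); rewrite ltxx.
split=> //; apply/eqP; rewrite eq_sym -subr_eq0.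
by move/eqP: b0; rewrite mulf_eq0 invr_eq0 (negbTE a0) orbF.
Qed.

Definition affine_off f s := forall a b : R, 0 <= a -> b <= 1 -> free s a b ->
  exists m c : R, forall x, a < x < b -> f x = m * x + c.

Lemma affine_off_merge f s s0 : affine_off f (s ++ s0) ->
  (forall t, t \in s -> 0 < t < 1 -> t \notin s0 -> derivable f t 1) ->
  affine_off f s0.
Proof.
elim: s => //= t s IHs fs fd; apply: IHs; last first.
  by move=> t' t's; apply: fd; rewrite inE t's orbT.
move=> a b a0 b1 fr; have [/andP[at' tb]|tab] := boolP (a < t < b); last first.
  apply: fs => // t'; rewrite inE => /predU1P[->|/fr//]; exact/negP.
have ts0 : t \notin s0.
  by apply/negP => ts; apply: (fr t); rewrite ?mem_cat ?ts ?orbT ?at'.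
have dt : derivable f t 1.
  by apply: fd => //; rewrite ?inE ?eqxx// (le_lt_trans a0)//= (lt_le_trans tb).
have [m1 [c1 f1]] : exists m c : R, forall x, a < x < t -> f x = m * x + c.
  apply: fs => //; first by rewrite (le_trans (ltW tb)).
  move=> t'; rewrite inE => /predU1P[->|t's]; first by rewrite ltxx andbF.
  by move=> /andP[? t't]; apply: (fr t' t's); rewrite (lt_trans t't) ?andbT.
have [m2 [c2 f2]] : exists m c : R, forall x, t < x < b -> f x = m * x + c.
  apply: fs => //; first by rewrite (le_trans a0)// ltW.
  move=> t'; rewrite inE => /predU1P[->|t's]; first by rewrite ltxx.
  by move=> /andP[tt' ?]; apply: (fr t' t's); rewrite (lt_trans at').
have [ft1 m1D] : f t = m1 * t + c1 /\ derive1 f t = m1.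
  apply: (@one_sided_slope f t (-1) m1 c1 (t - a)) => //.
  - by rewrite normrN1.
  - by rewrite subr_gt0.
  - by move=> h h0 hta; apply: f1; apply/andP; split; lra.
have [ft2 m2D] : f t = m2 * t + c2 /\ derive1 f t = m2.
  apply: (@one_sided_slope f t 1 m2 c2 (b - t)) => //.
  - by rewrite normr1.
  - by rewrite subr_gt0.
  - by move=> h h0 hta; apply: f2; apply/andP; split; lra.
have c12 : c1 = c2 by move: ft2; rewrite ft1 -m1D m2D => /addrI.
exists m1, c1 => x /andP[ax xb]; have [xt|xt|->//] := ltgtP x t.
  by apply: f1; rewrite ax.
by rewrite c12 -m1D m2D; apply: f2; rewrite xt.
Qed.

Lemma affine_off_pow2 f s0 : affine_off f s0 ->
  (forall x, 0 <= x < 1 -> f t @[t --> x^'+] --> f x) ->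
  (forall x, 0 < x < 1 -> x \notin s0 ->
    derivable f x 1 /\ exists k : int, derive1 f x = 2 ^ k) ->
  piecewise_pow2 f s0.
Proof.
move=> fs fc fd a b a0 ab b1 fr.
have [m [c fE]] := fs a b a0 b1 fr.
pose x := (a + b) / 2.
have [ax xb] : a < x /\ x < b by rewrite /x; split; lra.
have xs0 : x \notin s0 by apply/negP => /fr; apply; rewrite ax.
have [dx [k kE]] := fd x ltac:(lra) xs0.
have [_ mk] : f x = m * x + c /\ derive1 f x = m.
  apply: (@one_sided_slope f x 1 m c (b - x)) => //.
  - by rewrite normr1.
  - by rewrite subr_gt0.
  - by move=> h h0 hb; apply: fE; lra.
exists k, c => y /andP[]; rewrite le_eqVlt -kE mk => /predU1P[<-|ay yb]; last first.
  by apply: fE; rewrite ay.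
move=> _; apply/eqP/negPn/negP => fa.
have e0 : 0 < `|f a - (m * a + c)| by rewrite normr_gt0 subr_eq0.
set e := `|_| in e0.
have a01 : 0 <= a < 1 by lra.
have /cvgrPdist_lt/(_ (e / 2) ltac:(lra)) := fc a a01.
rewrite near_withinE => -[d /= d0 dP].
have m1 : 0 < `|m| + 1 by rewrite ltr_wpDl.
have [h [h0 hd hb he]] : exists h : R, [/\ 0 < h, h < d, h < b - a & h < e / 2 / (`|m| + 1)].
  by apply: pos_below3; [exact: d0|lra|apply: divr_gt0 => //; lra].
have := dP (a + h); rewrite /= opprD addNKr normrN gtr0_norm// => /(_ hd).
rewrite ltrDl => /(_ h0); rewrite (fE (a + h)); last by apply/andP; split; lra.
have : `|m * h| < e / 2.
  rewrite normrM (gtr0_norm h0); rewrite ltr_pdivlMr// in he.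
  apply: le_lt_trans he; rewrite mulrC ler_pM2l//; lra.
have -> : f a - (m * (a + h) + c) = (f a - (m * a + c)) - m * h by ring.
move=> mh dh; have := ler_normD (f a - (m * a + c) - m * h) (m * h).
by rewrite subrK -/e; lra.
Qed.

End Derivative.

Definition circle (R : realType) := {t : R | 0 <= t < 1}.
HB.instance Definition _ (R : realType) := SubChoice.on (circle R).

Definition circle_exp (R : realType) (t : circle R) : R * R :=
  (cos (2 * pi * val t), sin (2 * pi * val t)).

HB.instance Definition _ (R : realType) :=
  Topological.copy (circle R) (initial_topology (@circle_exp R)).

Section CircleTopology.
Variable R : realType.
Implicit Types (x y : circle R) (t : R).

Let cs t : R * R := (cos (2 * pi * t), sin (2 * pi * t)).

Let cs_continuous : continuous cs.
Proof.
have mc : continuous (fun t : R => 2 * pi * t) by move=> t; exact: mulrl_continuous.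
have c t : {for t, continuous (fun t : R => cos (2 * pi * t))}.
  by apply: (continuous_comp (mc t)); exact: continuous_cos.
have s t : {for t, continuous (fun t : R => sin (2 * pi * t))}.
  by apply: (continuous_comp (mc t)); exact: continuous_sin.
by move=> t; exact: (cvg_pair (c t) (s t)).
Qed.

Let cs_inj t u : 0 <= u <= t -> t < 1 + u -> cs t = cs u -> t = u.
Proof.
move=> /andP[u0 ut] tu [ec es]; apply/eqP; rewrite eq_le ut andbT leNgt.
apply/negP => lt.
have : cos (2 * (pi * (t - u))) = 1.
  have -> : 2 * (pi * (t - u)) = 2 * pi * t - 2 * pi * u by ring.
  by rewrite cosB ec es -!expr2 cos2Dsin2.
have -> : 2 * (pi * (t - u)) = pi * (t - u) *+ 2 by rewrite mulr2n; ring.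
rewrite cos_mulr2n cos2sin2 => e.
have : 0 < sin (pi * (t - u)).
  apply: sin_gt0_pi; rewrite mulr_gt0 ?pi_gt0 ?subr_gt0//=.
  by rewrite gtr_pMr ?pi_gt0//; lra.
move=> /(exprn_gt0 2); move: e; rewrite mulr2n; lra.
Qed.

Let cs1 t : cs (t + 1) = cs t.
Proof.
rewrite /cs; have -> : 2 * pi * (t + 1) = 2 * pi * t + pi *+ 2.
  by rewrite mulr2n; ring.
by rewrite cosD2pi sinD2pi.
Qed.

Lemma nbhs_circleP x (A : set (circle R)) : nbhs x A <->
  exists2 e : R, 0 < e & forall y,
    (`|val y - val x| < e \/ val x = 0 /\ 1 - e < val y) -> A y.
Proof.
have /andP[x0 x1] := valP x; split.
  rewrite nbhsE => -[_ [[W oW <-] /= Wx] WA].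
  have oW' : open (cs @^-1` W) by apply: open_comp => // t _; exact: cs_continuous.
  have nx : nbhs (val x) (cs @^-1` W) by apply: open_nbhs_nbhs.
  have nx1 : nbhs (val x + 1) (cs @^-1` W).
    by apply: open_nbhs_nbhs; split=> //=; rewrite cs1.
  have [d1 /= d10 d1P] := nx; have [d2 /= d20 d2P] := nx1.
  exists (Num.min d1 d2); first by rewrite lt_min d10.
  move=> y; rewrite lt_min => -[/andP[yx _]|[xz yd]].
    by apply: WA; apply: (d1P (val y)); rewrite /= distrC.
  apply: WA; apply: (d2P (val y)) => /=; rewrite xz add0r gtr0_norm.
    by move: yd; rewrite ltrBlDr -ltrBlDl lt_min => /andP[].
  by rewrite subr_gt0; case/andP: (valP y).
move=> [e e0 eA].
pose K := [set t : R | t \in `[0, 1] /\ (e <= `|t - val x| /\ (val x = 0 -> t <= 1 - e))].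
have cK : compact K.
  apply: (subclosed_compact _ (@segment_compact R 0 1)) => [|t []//].
  have -> : K = `[0, 1]%classic `&` ([set t | e <= `|t - val x|] `&`
      [set t | val x = 0 -> t <= 1 - e]) by [].
  apply: closedI; first exact: interval_closed.
  apply: closedI.
    have -> : [set t | e <= `|t - val x|] = (fun t => `|t - val x|) @^-1` [set t | e <= t] by [].
    apply: preimage_closed; last exact: closed_ge.
    move=> t _; apply: (@continuous_comp _ _ _ (fun t => t - val x) Num.norm).
      by apply: cvgB; [exact: cvg_id|exact: cvg_cst].
    exact: norm_continuous.
  have [xz|xz] := pselect (val x = 0).
    have -> : [set t : R | val x = 0 -> t <= 1 - e] = [set t | t <= 1 - e].
      by apply/seteqP; split=> t /= => [/(_ xz)//|? _].
    exact: closed_le.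
  have -> : [set t : R | val x = 0 -> t <= 1 - e] = setT.
    by apply/seteqP; split=> // t _ /xz.
  exact: closedT.
have cI : closed (cs @` K).
  apply: compact_closed; last first.
    by apply: continuous_compact => //; apply: continuous_subspaceT.
  exact: (@norm_hausdorff _ (R * R)%type).
rewrite nbhsE; exists (@circle_exp R @^-1` (~` (cs @` K))).
  split; first by exists (~` (cs @` K)) => //; exact: closed_openC.
  move=> [t [+ [te tx]] /= ct]; rewrite in_itv/= => /andP[t0 t1].
  have [lt|lt] := leP t (val x).
    have xt : val x = t.
      by apply: cs_inj; [rewrite t0|lra|].
    by move: te; rewrite xt subrr normr0 leNgt e0.
  have [tx1|tx1] := ltP t (1 + val x).
    have xt : t = val x by apply: cs_inj; [rewrite x0 ltW|lra|].
    by move: te; rewrite xt subrr normr0 leNgt e0.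
  have xz : val x = 0 by lra.
  by have := tx xz; lra.
move=> y /= nK; apply: eA; apply: contrapT => /not_orP[/negP ny nxy].
apply: nK; exists (val y) => //; have /andP[y0 y1] := valP y.
split; first by rewrite in_itv/= y0 ltW.
split; first by rewrite leNgt.
by move=> xz; rewrite leNgt; apply/negP => ?; apply: nxy.
Qed.

End CircleTopology.

(* A self-map of [0, 1) as a function on the line, with a junk value outside
   [0, 1), so that derivatives at points of ]0, 1[ make sense.                *)
Definition unroll (R : realType) (g : circle R -> circle R) (t : R) : R :=
  if insub t is Some x then val (g x) else 0.

Definition nondiff (R : realType) (g : circle R -> circle R) : set R :=
  [set x : R | 0 < x < 1 /\ ~ derivable (unroll g) x 1].

(* Differentiability is only considered at interior points: the end point 0 is
   dyadic, and at 0 there is only a one-sided derivative, which by piecewise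
   linearity is a slope of [g] at nearby interior points.                     *)
Record thompsonV (R : realType) (g : circle R -> circle R) : Prop := ThompsonV {
  thompsonV_bij : bijective g;
  thompsonV_pl : piecewise_linear (unroll g);
  thompsonV_right_continuous : forall x, 0 <= x < 1 ->
    unroll g t @[t --> x^'+] --> unroll g x;
  thompsonV_finite : finite_set (nondiff g);
  thompsonV_dyadic : nondiff g `<=` @dyadic R;
  thompsonV_slope : forall x, 0 < x < 1 -> derivable (unroll g) x 1 ->
    exists k : int, derive1 (unroll g) x = 2 ^ k
}.

Record thompsonT (R : realType) (g : circle R -> circle R) : Prop := ThompsonT {
  thompsonT_V : thompsonV g;
  thompsonT_discontinuity : forall x y, 0 <= x < 1 -> 0 <= y < 1 ->
    ~ continuous01 (unroll g) x -> ~ continuous01 (unroll g) y -> x = y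
}.

Section ThompsonGroup.
Variable R : realType.
Implicit Types (g h : circle R -> circle R) (x y : circle R) (s : seq R).

Lemma unrollE g x : unroll g (val x) = val (g x).
Proof. by rewrite /unroll valK. Qed.

Lemma circle_ex (t : R) : 0 <= t < 1 -> exists x : circle R, val x = t.
Proof. by move=> t01; exists (Sub t t01); rewrite SubK. Qed.

Lemma unroll_maps01 g : maps01 (unroll g).
Proof. by move=> t /circle_ex[x <-]; rewrite unrollE; exact: (valP (g x)). Qed.

Lemma unroll_inverse g h : cancel g h -> cancel h g ->
  inverse01 (unroll g) (unroll h).
Proof.
move=> gh hg; split; first exact: unroll_maps01.
split; first exact: unroll_maps01.
by move=> t /circle_ex[x <-]; rewrite !unrollE gh hg.
Qed.

Lemma unroll_comp g h (t : R) : 0 <= t < 1 ->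
  unroll (g \o h) t = unroll g (unroll h t).
Proof. by move=> /circle_ex[x <-]; rewrite !unrollE. Qed.

Lemma eq_piecewise_pow2 (f f' : R -> R) s :
  (forall t, 0 <= t < 1 -> f t = f' t) -> piecewise_pow2 f s -> piecewise_pow2 f' s.
Proof.
move=> ff' fs a b a0 ab b1 fr; have [k [c fE]] := fs a b a0 ab b1 fr.
exists k, c => t /andP[at' tb]; rewrite -ff' ?fE ?at'//.
by rewrite (le_trans a0)//= (lt_le_trans tb).
Qed.

Lemma thompsonV_piecewise g : thompsonV g ->
  exists2 s, (forall t, t \in s -> dyadic t) & piecewise_pow2 (unroll g) s.
Proof.
move=> [_ [s0 gs0] gc /finite_seqP[s sE] gd gk].
have ds t : t \in s -> dyadic t.
  by move=> ts; apply: gd; rewrite sE.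
exists s => //; apply: affine_off_pow2 => //.
  apply: (@affine_off_merge _ _ s0) => [a b a0 b1 fr|t _ t01 ts].
    by apply: gs0 => // t ts; apply: fr; rewrite mem_cat ts.
  apply: contrapT => nd; case/negP: ts.
  by have : nondiff g t by []; rewrite sE.
move=> x x01 xs; have dx : derivable (unroll g) x 1.
  apply: contrapT => nd; case/negP: xs.
  by have : nondiff g x by []; rewrite sE.
by split=> //; exact: gk.
Qed.

Lemma affine_derivable (f : R -> R) (m c u v x : R) : u < x -> x < v ->
  (forall y : R, u < y < v -> f y = m * y + c) -> derivable f x 1 /\ derive1 f x = m.
Proof.
move=> ux xv fE.
pose g : R -> R := m \*: (@id R) + cst c.
have dg : is_derive x 1 g (m *: 1 + 0) by apply: is_deriveD.
have fg : {near x, g =1 f}.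
  near=> y; rewrite fE//; apply/andP; split; near: y.
    exact: lt_nbhsr.
  exact: lt_nbhsl.
case: dg => d1 d2; split; first by apply: near_eq_derivable d1; rewrite ?oner_eq0.
by rewrite derive1E -(near_eq_derive _ fg) ?oner_neq0// d2 addr0 [LHS]mulr1.
Unshelve. all: by end_near. Qed.

Lemma piecewise_thompsonV g s : bijective g -> (forall t, t \in s -> dyadic t) ->
  piecewise_pow2 (unroll g) s -> thompsonV g.
Proof.
move=> bg ds gs; have [h gh hg] := bg.
have ih := unroll_inverse gh hg.
have nd : nondiff g `<=` [set` s].
  move=> t [t01 dt] /=; apply/negPn/negP => ts; apply: dt.
  have [u [v [k [c [/andP[u0 ut] /andP[tv _] _ fE]]]]] := piece_around gs t01 ts.
  apply: (affine_derivable (m := 2 ^ k) (c := c) ut tv _).1 => y /andP[uy yv].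
  by apply: fE; rewrite yv ltW.
split=> //.
- exists s => a b a0 b1 fr; have [ab|ba] := ltP a b; last first.
    by exists 0, 0 => x /andP[ax xb]; have := lt_trans ax xb; rewrite ltNge ba.
  have [k [c fE]] := gs a b a0 ab b1 fr; exists (2 ^ k), c => x /andP[ax xb].
  by apply: fE; rewrite xb ltW.
- move=> x x01; have [v [k [c [xv _ fE]]]] := piecewise_right gs x01.
  apply/cvgrPdist_lt => e e0.
  have [d d0 dP] := affine_right xv fE e0.
  rewrite near_withinE; exists d => //= y yx xy.
  have {}yx : `|y - x| < d by rewrite distrC.
  move: yx; rewrite ltr_distl => /andP[_ yx].
  have /andP[? ?] := dP y (ltW xy) ltac:(lra).
  by rewrite distrC ltr_distl; apply/andP; split; lra.
- by apply: sub_finite_set nd _; exact: finite_seq.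
- by move=> t /nd; exact: ds.
- move=> x /andP[x0 x1] dx.
  have x01 : 0 <= x < 1 by rewrite ltW.
  have [v [k [c [xv _ fE]]]] := piecewise_right gs x01.
  exists k; have [] // := @one_sided_slope _ _ x 1 (2 ^ k) c (v - x) dx.
  + by rewrite normr1.
  + by rewrite subr_gt0.
  + by move=> t t0 tv; apply: fE; apply/andP; split; lra.
Qed.

Lemma nbhs_circle_ex x (A : set (circle R)) (e : R) : 0 < e ->
  (forall y, (`|val y - val x| < e \/ val x = 0 /\ 1 - e < val y) -> A y) ->
  nbhs x A.
Proof. by move=> e0 eA; apply/nbhs_circleP; exists e. Qed.

Lemma thompsonT_continuous g : thompsonT g -> continuous g.
Proof.
move=> [gV gd] x; have [s ds gs] := thompsonV_piecewise gV.
have [h gh hg] := thompsonV_bij gV; have ih := unroll_inverse gh hg.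
move=> A /= /nbhs_circleP[e e0 eA].
have x01 := valP x; have /andP[x0 x1] := x01.
have [v [k [c [xv _ fE]]]] := piecewise_right gs x01.
have [d1 d10 d1P] := affine_right xv fE e0.
have right y : val x <= val y -> val y < val x + d1 -> A (g y).
  move=> xy yd; apply: eA; left; have := d1P _ xy yd.
  by rewrite !unrollE ltr_distl => /andP[? ?]; apply/andP; split; lra.
pose p := if val x == 0 then 1 else val x.
have p01 : 0 < p <= 1.
  rewrite /p; case: eqVneq => xn; first by rewrite ltr01 lexx.
  by rewrite lt_def xn x0 ltW.
have pxd : val x = 0 /\ p = 1 \/ 0 < val x /\ p = val x.
  rewrite /p; case: eqVneq => [->|xn]; [by left|right].
  by rewrite lt_def xn.
have [w ll] := left_lim_ex gs p01.
have [d2 d20 d2P] := affine_left ll e0.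
have wE : w = wrap (val (g x)).
  rewrite (left_lim_wrap ih gs gd ll) -(unrollE g x).
  case: pxd => -[xz ->]; first by rewrite eqxx xz.
  by rewrite lt_eqF.
have left y : p - d2 < val y -> val y < p -> A (g y).
  move=> yd yp; apply: eA; have := d2P _ yd yp.
  rewrite unrollE wE /wrap; case: eqVneq => [gz|_] /andP[? ?].
    by right.
  by left; rewrite ltr_distl; apply/andP; split; lra.
have [e' [e'0 e'1 e'2 e'3]] : exists e' : R,
    [/\ 0 < e', e' < d1, e' < d2 & e' < 1 / 2].
  by apply: pos_below3 => //; lra.
apply: (@nbhs_circle_ex _ _ e') => // y; have /andP[y0 y1] := valP y.
have [xy|yx] := leP (val x) (val y).
  move=> [|[xz yd]].
    by rewrite ltr_distl => /andP[_ ?]; apply: right => //; lra.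
  by apply: left; case: pxd => -[]; lra.
move=> [|[xz]]; last by lra.
rewrite ltr_distl => /andP[? _].
by apply: left; case: pxd => -[]; lra.
Qed.

Lemma continuous_thompsonT g : thompsonV g -> continuous g -> thompsonT g.
Proof.
move=> gV gc; split=> //.
have [h gh hg] := thompsonV_bij gV.
suff H x : ~ continuous01 (unroll g) (val x) -> val (g x) = 0.
  move=> _ _ /circle_ex[x <-] /circle_ex[y <-] /H gx /H gy.
  by congr val; apply: (can_inj gh); apply: val_inj; rewrite gx gy.
move=> dx; apply: contrapT => /eqP gx; apply: dx.
apply/continuous01P => e e0.
have gx0 : 0 < val (g x) by rewrite lt_def gx; case/andP: (valP (g x)).
have : nbhs (g x) [set y : circle R | `|val y - val (g x)| < e].
  apply: (@nbhs_circle_ex _ _ e) => // y [//|[gz]].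
  by move: gx; rewrite gz eqxx.
move=> /gc /nbhs_circleP[d d0 dP]; exists d => // _ /circle_ex[y <-] yx.
by rewrite !unrollE; apply: (dP y); left.
Qed.

Lemma thompsonT_id : thompsonT (@id (circle R)).
Proof.
apply: continuous_thompsonT; last by move=> x; exact: cvg_id.
apply: (@piecewise_thompsonV _ [::]) => //; first by exists id.
move=> a b a0 ab b1 _; exists 0, 0 => t /andP[at' tb].
have [x <-] : exists x : circle R, val x = t.
  by apply: circle_ex; rewrite (le_trans a0)//= (lt_le_trans tb).
by rewrite unrollE expr0z mul1r addr0.
Qed.

Lemma thompsonT_comp g h : thompsonT g -> thompsonT h -> thompsonT (g \o h).
Proof.
move=> gT hT; apply: continuous_thompsonT; last first.
  by move=> x; apply: continuous_comp; exact: thompsonT_continuous.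
have [gV _] := gT; have [hV _] := hT.
have [s1 ds1 gs1] := thompsonV_piecewise gV.
have [s2 ds2 gs2] := thompsonV_piecewise hV.
have [g' gg' g'g] := thompsonV_bij gV; have [h' hh' h'h] := thompsonV_bij hV.
have ih := unroll_inverse hh' h'h.
apply: (@piecewise_thompsonV _ (s2 ++ [seq unroll h' t | t <- s1 & 0 <= t < 1])).
- by exists (h' \o g') => x /=; rewrite ?gg' ?hh' ?h'h ?g'g.
- move=> t; rewrite mem_cat => /orP[/ds2//|/mapP[u]].
  rewrite mem_filter => /andP[u01 /ds1 du] ->.
  have h'u := unroll_maps01 h' u01.
  apply/(dyadic_piece ih gs2 ds2 h'u).
  by have [_ [_ /(_ u u01)[_ ->]]] := ih.
- apply: (eq_piecewise_pow2 _ (piecewise_pow2_comp ih gs2 gs1)).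
  by move=> t t01; rewrite unroll_comp.
Qed.

Lemma thompsonT_inv g h : cancel g h -> cancel h g -> thompsonT g -> thompsonT h.
Proof.
move=> gh hg [gV gd]; have [s ds gs] := thompsonV_piecewise gV.
have ih := unroll_inverse gh hg; split.
  apply: (piecewise_thompsonV _ _ (piecewise_pow2_inv ih gs)); first by exists g.
  move=> t /mapP[u]; rewrite mem_filter => /andP[u01 us] ->.
  exact: (dyadic_break ih gs ds).
by move=> x y x01 y01 /(disc_inv ih gs gd x01) -> /(disc_inv ih gs gd y01).
Qed.

End ThompsonGroup.

Definition thompson_group (R : realType) :=
  {g : circle R -> circle R | `[< thompsonT g >]}.
HB.instance Definition _ (R : realType) := SubChoice.on (thompson_group R).

Section ThompsonGroupType.
Variable R : realType.
Implicit Types g h : thompson_group R.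

Lemma thompsonP g : thompsonT (val g).
Proof. by apply/asboolP; exact: (valP g). Qed.

Definition thompson_of (f : circle R -> circle R) (fT : thompsonT f) :
  thompson_group R := Sub f (asboolT fT).

Definition thompson_one : thompson_group R := thompson_of (thompsonT_id R).

(* Elements act on the left: [g * h] is [g] after [h] *)
Definition thompson_mul g h : thompson_group R :=
  thompson_of (thompsonT_comp (thompsonP g) (thompsonP h)).

Lemma thompson_inv_ex g : exists h, cancel (val g) (val h) /\ cancel (val h) (val g).
Proof.
have [h gh hg] := thompsonV_bij (thompsonT_V (thompsonP g)).
by exists (thompson_of (thompsonT_inv gh hg (thompsonP g))).
Qed.

Definition thompson_inv g : thompson_group R := projT1 (cid (thompson_inv_ex g)).

Lemma thompson_mulA : associative thompson_mul.
Proof. by move=> f g h; apply: val_inj. Qed.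

Lemma thompson_1mul : left_id thompson_one thompson_mul.
Proof. by move=> g; apply: val_inj. Qed.

Lemma thompson_mul1 : right_id thompson_one thompson_mul.
Proof. by move=> g; apply: val_inj. Qed.

Lemma thompson_Vmul : left_inverse thompson_one thompson_inv thompson_mul.
Proof.
move=> g; apply: val_inj; apply/funext => x /=.
by rewrite /thompson_inv; case: cid => h [gh hg] /=; exact: gh.
Qed.

Lemma thompson_mulV : right_inverse thompson_one thompson_inv thompson_mul.
Proof.
move=> g; apply: val_inj; apply/funext => x /=.
by rewrite /thompson_inv; case: cid => h [gh hg] /=; exact: hg.
Qed.

HB.instance Definition _ := isGroup.Build (thompson_group R)
  thompson_mulA thompson_1mul thompson_mul1 thompson_Vmul thompson_mulV.

Definition thompson_act (g : thompson_group R) (x : circle R) : circle R := val g x.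

Lemma thompson_act1 x : thompson_act 1%g x = x.
Proof. by []. Qed.

Lemma thompson_actM g h x :
  thompson_act (g * h)%g x = thompson_act g (thompson_act h x).
Proof. by []. Qed.

Lemma thompson_act_continuous g : continuous (thompson_act g).
Proof. exact: thompsonT_continuous (thompsonP g). Qed.

Definition thompson_action : group_action (thompson_group R) (circle R) :=
  GroupAction thompson_act1 thompson_actM thompson_act_continuous.

End ThompsonGroupType.

(* Main.v *)
From HB Require Import structures.
Require Import Defs.
From mathcomp Require Import reals.
From mathcomp Require Import all_boot all_order all_algebra finmap.
From mathcomp Require Import ring lra zify.
From mathcomp Require Import all_classical all_analysis measurable_realfun.
Set Implicit Arguments.
Unset Strict Implicit.
Unset Printing Implicit Defensive.
Import Order.TTheory GRing.Theory Num.Theory.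
Import numFieldNormedType.Exports.
Local Open Scope classical_set_scope.
Local Open Scope ring_scope.

(** The unit space splits into two invariant Borel pieces, the dyadic and the
    non-dyadic points.  On each piece, every point x is the range of a family of
    arrows indexed by pairs of natural numbers, and an element of the groupoid
    carries the family of its source to the family of its range up to a shift of
    the indices.

    At a non-dyadic point x an element of T is locally t |-> 2^k t + c with c
    dyadic.  Doubling modulo 1 is, on each quarter of the circle, the restriction
    of an element of T, so the forward orbit of x under doubling is realised by
    germs [expand i x, x], which near x are t |-> 2^i t modulo 1.  If g is in T and
    g(t) = 2^k t + c near x, then for i large 2^i c is an integer, so that
    2^i (2^k t + c) and 2^(i + k) t agree modulo 1: the doubling orbits of x and g x
    merge, up to a shift of time ([expand_germ]).

    The dyadic points form a single orbit, on which rotations select a base arrow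
    from 0 to each point, and the isotropy group of 0 is Z^2: a germ of T fixing 0
    is determined by the logarithms of its left and right slopes.  Hence g carries
    the base arrow of x to the base arrow of g x followed by some element of Z^2
    ([isotropy_germ]).

    In both cases the arrows, written arrow i j x, satisfy
    g (arrow (i + p) (j + q) (s g)) = arrow (i + p') (j + q') (r g) for all i and
    j, with p, p', q, q' depending only on g; in the first case they do not depend
    on j.  The uniform average of the point masses at arrow i j x over the square
    i, j <= n is then asymptotically invariant, because shifting an n by n square
    by a bounded vector changes a proportion O(1/n) of it
    ([borel_amenable_of_arrows]).  Measurability is automatic, since T is countable
    and each arrow is the germ of an element of T that depends on x in a Borel way
    ([germ_groupoid_borel_amenable]). *)

(** * Topology of the groupoid of germs *)

Section GermTopology.
Variables (Gam : groupType) (X : topologicalType) (a : group_action Gam X).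
Implicit Types (g h : Gam) (x y : X).

Definition slice g (U : set X) : set (germs a) := [set germ a g x | x in U].

Lemma slice_open g (U : set X) : open U -> open (slice g U).
Proof.
move=> oU; exists [set slice g U]; last by rewrite bigcup_set1.
move=> _ ->; exists [fset (slice g U : set (germs a))]%fset; last first.
  by rewrite /= set_fset1 bigcap_set1.
by move=> A /fset1P ->; rewrite inE /=; exists g, U.
Qed.

(** The slices form a basis and not only a subbase, because two group elements
    with the same germ at a point agree on an open set; all topological
    properties of the groupoid are read off from this description. *)
Lemma nbhs_germP g x (A : set (germs a)) : nbhs (germ a g x) A <->
  exists U : set X, [/\ open U, U x & slice g U `<=` A].
Proof.
split=> [|[U [oU Ux UA]]]; last first.
  by rewrite nbhsE; exists (slice g U) => //; split; [exact: slice_open|exists x].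
rewrite nbhsE => -[_ [[F FI <-] [B FB Bx]] FA].
have [D DI BE] := FI _ FB.
(* A neighbourhood contains a finite intersection of slices through the point;
   it remains to find one slice inside it. *)
suff [U [oU Ux UB]] : exists U : set X, [/\ open U, U x & slice g U `<=` B].
  by exists U; split=> // c /UB Bc; apply: FA; exists B.
move: Bx; rewrite -{B FB}BE => Bx.
have {}DI A' : A' \in D -> exists U : set X, [/\ open U, U x & slice g U `<=` A'].
  move=> DA; have := DI _ DA; rewrite inE /= => -[h [V [oV AE]]].
  have : A' (germ a g x) by exact: Bx.
  rewrite AE => -[y Vy /germ_eq[yx e]].
  move: (e : nbhs _ _); rewrite nbhsE => -[W [oW Wy] We].
  exists (V `&` W); split; first exact: openI.
    by rewrite -yx.
  move=> _ [z [Vz Wz] <-]; exists z => //; apply/germ_eq; split=> //.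
  by apply: (_ : nbhs _ _); rewrite nbhsE; exists W.
elim/finSet_rect: D DI Bx => D IH DI Bx.
have [->|[A' DA]] := fset_0Vmem D.
  by exists setT; split; [exact: openT|by []|move=> c _ B; rewrite /= inE].
have [|||U [oU Ux UD]] := IH (D `\ A')%fset.
- by rewrite fproperD1.
- by move=> C; rewrite in_fsetD1 => /andP[_ /DI].
- by move=> C /=; rewrite in_fsetD1 => /andP[_ /Bx].
have [V [oV Vx VA]] := DI _ DA.
exists (U `&` V); split; [exact: openI|by []|].
move=> _ [z [Uz Vz] <-] C /= DC.
have [->|CA] := eqVneq C A'; first by apply: VA; exists z.
by apply: UD; [exists z|rewrite /= in_fsetD1 CA].
Qed.

Lemma open_act_preimage g (U : set X) : open U -> open (a g @^-1` U).
Proof. by move=> oU; apply: open_comp => // y _; exact: act_continuous. Qed.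

Lemma act_image g (U : set X) : a g @` U = a g^-1%g @^-1` U.
Proof.
apply/seteqP; split=> [_ [z Uz <-]|z Uz] /=; first by rewrite actVK.
by exists (a g^-1%g z) => //; rewrite actKV.
Qed.

Lemma germ_src_continuous : continuous (@germ_src _ _ a).
Proof.
move=> c; elim/germP: c => g x A; rewrite germ_srcE nbhsE => -[U [oU Ux] UA].
apply/nbhs_germP; exists U; split=> // _ [z Uz <-] /=.
by rewrite germ_srcE; exact: UA.
Qed.

Lemma germ_rng_continuous : continuous (@germ_rng _ _ a).
Proof.
move=> c; elim/germP: c => g x A; rewrite germ_rngE nbhsE => -[U [oU Ux] UA].
apply/nbhs_germP; exists (a g @^-1` U); split=> //; first exact: open_act_preimage.
by move=> _ [z Uz <-] /=; rewrite germ_rngE; exact: UA.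
Qed.

Lemma germ_continuous g : continuous (germ a g).
Proof.
move=> x A /nbhs_germP[U [oU Ux UA]]; rewrite nbhsE; exists U => // z Uz.
by apply: UA; exists z.
Qed.

Lemma germ_inv_continuous : continuous (@germ_inv _ _ a).
Proof.
move=> c; elim/germP: c => g x A; rewrite germ_invE => /nbhs_germP[U [oU Ux UA]].
apply/nbhs_germP; exists (a g @^-1` U); split=> //; first exact: open_act_preimage.
by move=> _ [z Uz <-] /=; rewrite germ_invE; apply: UA; exists (a g z).
Qed.

Lemma germ_mul_continuous :
  {within [set ab : germs a * germs a | germ_src ab.1 = germ_rng ab.2],
    continuous (fun ab => germ_mul ab.1 ab.2)}.
Proof.
apply/subspace_continuousP => -[c d] /=.
elim/germP: c => h y; elim/germP: d => g x; rewrite germ_srcE germ_rngE => ->.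
move=> A; rewrite /from_subspace /= germ_mulE => /nbhs_germP[U [oU Ux UA]].
exists (slice h setT, slice g U) => /=.
  split; apply/nbhs_germP; first by exists setT; split; [exact: openT|by []|].
  by exists U; split.
move=> -[_ _] /= [[z _ <-] [t Ut <-]]; rewrite germ_srcE germ_rngE => ->.
by rewrite germ_mulE; apply: UA; exists t.
Qed.

Lemma slice_inj (f : germs a -> X) g :
  (forall x y, f (germ a g x) = f (germ a g y) -> x = y) ->
  set_inj (slice g setT) f.
Proof.
move=> fg c d /set_mem[x _ <-] /set_mem[y _ <-] /fg -> //.
Qed.

Lemma germ_src_local_homeo : local_homeomorphism (@germ_src _ _ a).
Proof.
elim/germP => g x; exists (slice g setT); split.
- by apply: slice_open; exact: openT.
- by exists x.
- by apply: slice_inj => y z; rewrite !germ_srcE.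
- by apply: continuous_subspaceT; exact: germ_src_continuous.
move=> V oV VU; rewrite openE => _ [c Vc <-].
have [y _ yc] := VU _ Vc; rewrite -yc germ_srcE /interior.
have : nbhs c V by exact: open_nbhs_nbhs.
rewrite -yc => /nbhs_germP[W [oW Wy WV]]; rewrite nbhsE; exists W => // z Wz.
by exists (germ a g z); [apply: WV; exists z|rewrite germ_srcE].
Qed.

Lemma germ_rng_local_homeo : local_homeomorphism (@germ_rng _ _ a).
Proof.
elim/germP => g x; exists (slice g setT); split.
- by apply: slice_open; exact: openT.
- by exists x.
- apply: slice_inj => y z; rewrite !germ_rngE; exact: (can_inj (actVK a g)).
- by apply: continuous_subspaceT; exact: germ_rng_continuous.
move=> V oV VU.
have -> : @germ_rng _ _ a @` V = a g @` (@germ_src _ _ a @` V).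
  apply/seteqP; split=> [_ [c Vc <-]|_ [_ [c Vc <-] <-]].
    have [y _ yc] := VU _ Vc; rewrite -yc germ_rngE; exists y => //.
    by exists c => //; rewrite -yc germ_srcE.
  exists c => //; have [y _ <-] := VU _ Vc; by rewrite germ_rngE germ_srcE.
rewrite act_image; apply: open_act_preimage.
rewrite openE => _ [c Vc <-].
have [y _ yc] := VU _ Vc; rewrite -yc germ_srcE /interior.
have : nbhs c V by exact: open_nbhs_nbhs.
rewrite -yc => /nbhs_germP[W [oW Wy WV]]; rewrite nbhsE; exists W => // z Wz.
by exists (germ a g z); [apply: WV; exists z|rewrite germ_srcE].
Qed.

Lemma germ_groupoid_etale : hausdorff_space X -> etale (germ_groupoid a).
Proof.
move=> hX; split=> //; last 2 first.
- exact: germ_src_local_homeo.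
- exact: germ_rng_local_homeo.
split.
- exact: germ_src_continuous.
- exact: germ_rng_continuous.
- exact: germ_continuous.
- exact: germ_inv_continuous.
- exact: germ_mul_continuous.
Qed.

Lemma germs_second_countable : countable [set: Gam] -> @second_countable X ->
  @second_countable (germs a).
Proof.
move=> cG [B cB [oB BX]].
exists [set slice p.1 p.2 | p in [set: Gam] `*` B].
  apply: sub_countable (countableX cG cB); exact: card_image_le.
split=> [_ [[g U] [_ BU] <-]|c]; first by apply: slice_open; exact: oB.
elim/germP: c => g x A /nbhs_germP[U [oU Ux UA]].
have [V [BV Vx] VU] := BX x U (open_nbhs_nbhs (conj oU Ux)).
exists (slice g V); first by split; [exists (g, V)|exists x].
by move=> _ [z Vz <-]; apply: UA; exists z => //; exact: VU.
Qed.

End GermTopology.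

(** * Asymptotic invariance of averages over squares *)

Section BoxSums.
Variables (R : realType) (T : choiceType).
Implicit Types (D : set T) (F : nat -> nat -> R) (phi : T -> R) (u : nat -> nat -> T).

Lemma sum_shift_le (F : nat -> R) m p n : (m + p <= n)%N -> (forall i, 0 <= F i) ->
  \sum_(0 <= i < m) F (i + p)%N <= \sum_(0 <= i < n) F i.
Proof.
move=> mpn F0; have pn : (p <= n)%N by apply: leq_trans mpn; rewrite leq_addl.
rewrite [leRHS](big_cat_nat (n := p))//= -[leLHS]add0r lerD ?sumr_ge0//.
rewrite -{2}[p]add0n big_addn [leRHS](big_cat_nat (n := m) (p := (n - p)%N))//=; last first.
  by rewrite leq_subRL// addnC.
by rewrite lerDl sumr_ge0.
Qed.

Lemma box_shift_le F m p q n : (m + p <= n)%N -> (m + q <= n)%N ->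
  (forall i j, 0 <= F i j) ->
  \sum_(0 <= i < m) \sum_(0 <= j < m) F (i + p)%N (j + q)%N <=
  \sum_(0 <= i < n) \sum_(0 <= j < n) F i j.
Proof.
move=> mpn mqn F0; apply: le_trans (sum_shift_le mpn _); last first.
  by move=> i; rewrite sumr_ge0.
by apply: ler_sum => i _; apply: sum_shift_le.
Qed.

Lemma esum_delta D phi t : D t -> 0 <= phi t ->
  \esum_(s in D) (phi s * (s == t)%:R)%:E = (phi t)%:E.
Proof.
move=> Dt p0; rewrite -[RHS](@esum_set1 R T t (fun s => (phi s)%:E)) ?lee_fin//.
have -> : [set t] = D `&` [set t] by apply/seteqP; split=> [_ ->|s []].
rewrite esum_mkcondr; apply: eq_esum => s Ds.
have [->|st] := eqVneq s t; first by rewrite mem_set// mulr1.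
by rewrite memNset ?mulr0//; apply/eqP.
Qed.

(** Sums over a possibly uncountable index set only ever involve finitely many point
    masses, so they reduce to finite sums over the square. *)
Lemma esum_box D phi u m : (forall i j, D (u i j)) -> (forall t, 0 <= phi t) ->
  \esum_(t in D) (phi t * \sum_(0 <= i < m) \sum_(0 <= j < m) (t == u i j)%:R)%:E =
  (\sum_(0 <= i < m) \sum_(0 <= j < m) phi (u i j))%:E.
Proof.
move=> Du p0; rewrite -sumEFin.
under eq_esum do rewrite mulr_sumr -sumEFin.
rewrite esum_sum => [|t i _ _]; last first.
  by rewrite lee_fin mulr_ge0// sumr_ge0.
apply: eq_bigr => i _; rewrite -sumEFin.
under eq_esum do rewrite mulr_sumr -sumEFin.
rewrite esum_sum => [|t j _ _]; last by rewrite lee_fin mulr_ge0.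
by apply: eq_bigr => j _; exact: esum_delta.
Qed.

End BoxSums.

Section BorelFunctions.
Variables (R : realType) (X : topologicalType).

(** Measurable types are pointed, hence the choice of a base point; the empty
    space is dealt with by [borel_function_inhabited]. *)
Definition based (x0 : X) : Type := X.
HB.instance Definition _ (x0 : X) := Choice.on (based x0).
HB.instance Definition _ (x0 : X) := isPointed.Build (based x0) x0.

Definition borel_space (x0 : X) :=
  g_sigma_algebraType (@open X : set (set (based x0))).

Lemma borel_functionP (x0 : X) (f : X -> R) :
  borel_function f <-> measurable_fun [set: borel_space x0] (f : borel_space x0 -> R).
Proof.
split=> [bf _ B mB|mf B mB]; first by rewrite setTI; exact: bf.
by have := mf measurableT B mB; rewrite setTI.
Qed.

Lemma borel_function_inhabited (f : X -> R) :
  (X -> borel_function f) -> borel_function f.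
Proof.
move=> bf; have [[x0 _]|X0] := pselect (exists x0 : X, True); first exact: bf.
move=> B mB; rewrite (_ : _ @^-1` _ = set0); first exact: sigma_algebra0.
by apply/seteqP; split=> // x _; apply: X0; exists x.
Qed.

Lemma borel_functionZ c (f : X -> R) :
  borel_function f -> borel_function (fun x => c * f x).
Proof.
move=> bf; apply: borel_function_inhabited => x0; apply/(borel_functionP x0).
by apply: measurable_funM => //; apply/borel_functionP.
Qed.

Lemma borel_function_sum I (s : seq I) (f : I -> X -> R) :
  (forall i, borel_function (f i)) -> borel_function (fun x => \sum_(i <- s) f i x).
Proof.
move=> bf; apply: borel_function_inhabited => x0; apply/(borel_functionP x0).
by apply: measurable_sum => i; apply/borel_functionP.
Qed.

End BorelFunctions.

Section BoxAverages.
Variables (R : realType) (G : groupoid).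
Variable arrow : nat -> nat -> gobj G -> garr G.

(** The side of the square is [n.+1], so that the average is never empty. *)
Definition box_average (n : nat) (x : gobj G) (g : garr G) : R :=
  n.+1%:R ^- 2 *
  \sum_(0 <= i < n.+1) \sum_(0 <= j < n.+1) (g == arrow i j x)%:R.

Hypothesis rng_arrow : forall i j x, grng (arrow i j x) = x.

Lemma sum_box_cst m (c : R) :
  \sum_(0 <= i < m) \sum_(0 <= j < m) c = m%:R ^+ 2 * c.
Proof.
rewrite sumr_const_nat subn0 sumr_const_nat subn0 -mulrnA -[LHS]mulr_natl natrM.
by rewrite expr2.
Qed.

Lemma box_average_ge0 n x g : 0 <= box_average n x g.
Proof.
by rewrite mulr_ge0 ?invr_ge0 ?exprn_ge0// sumr_ge0// => i _; rewrite sumr_ge0.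
Qed.

Lemma box_average_total n x :
  \esum_(g in grng @^-1` [set x]) (box_average n x g)%:E = 1%E.
Proof.
rewrite (@esum_box _ _ _ (cst (n.+1%:R ^- 2)) (fun i j => arrow i j x)) => [|i j|t].
- by rewrite sum_box_cst mulfV// expf_neq0.
- exact: rng_arrow.
- by rewrite invr_ge0 exprn_ge0.
Qed.

Lemma asum_box_average n x (f : garr G -> R) :
  asum (grng @^-1` [set x]) (fun g => f g * box_average n x g) =
  n.+1%:R ^- 2 * \sum_(0 <= i < n.+1) \sum_(0 <= j < n.+1) f (arrow i j x).
Proof.
have c0 : 0 <= n.+1%:R ^- 2 :> R by rewrite invr_ge0 exprn_ge0.
pose pos g := Num.max (f g) 0; pose neg g := Num.max (- f g) 0.
have part (h : garr G -> R) : (forall g, 0 <= h g) ->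
    \esum_(g in grng @^-1` [set x]) (h g * box_average n x g)%:E =
    (n.+1%:R ^- 2 *
      \sum_(0 <= i < n.+1) \sum_(0 <= j < n.+1) h (arrow i j x))%:E.
  move=> h0; under eq_esum do rewrite /box_average mulrA.
  rewrite (@esum_box _ _ _ (fun g => h g * n.+1%:R ^- 2)).
  - congr (_%:E); rewrite mulr_sumr; apply: eq_bigr => i _.
    by rewrite mulr_sumr; apply: eq_bigr => j _; rewrite mulrC.
  - by move=> i j; exact: rng_arrow.
  - by move=> g; rewrite mulr_ge0.
rewrite /asum.
have -> : \esum_(g in grng @^-1` [set x])
      ((EFin \o (fun g => f g * box_average n x g)%R)^\+%E g) =
    \esum_(g in grng @^-1` [set x]) (pos g * box_average n x g)%:E.
  apply: eq_esum => g _; rewrite funeposE /= -EFin_max; congr (_%:E).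
  by rewrite /pos maxr_pMl ?mul0r// box_average_ge0.
have -> : \esum_(g in grng @^-1` [set x])
      ((EFin \o (fun g => f g * box_average n x g)%R)^\-%E g) =
    \esum_(g in grng @^-1` [set x]) (neg g * box_average n x g)%:E.
  apply: eq_esum => g _; rewrite funenegE /= -EFin_max; congr (_%:E).
  by rewrite /neg maxr_pMl ?mul0r ?mulNr// box_average_ge0.
rewrite !part /=; last 2 first.
- by move=> g; rewrite /neg le_max lexx orbT.
- by move=> g; rewrite /pos le_max lexx orbT.
rewrite -mulrBr -sumrB; congr (_ * _); apply: eq_bigr => i _.
rewrite -sumrB; apply: eq_bigr => j _; rewrite /pos /neg.
by case: (leP (f (arrow i j x)) 0); case: (leP (- f (arrow i j x)) 0); lra.
Qed.

Lemma gmul_eq (g h b : garr G) : grng h = grng g -> gsrc g = grng b ->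
  (gmul (ginv g) h == b) = (h == gmul g b).
Proof.
move=> hg gb; apply/eqP/eqP => [<-|->].
  by rewrite gmulA ?grng_inv ?gsrc_inv// gmulV -hg g1mul.
by rewrite gmulA ?gsrc_inv// gVmul gb g1mul.
Qed.

(** The squares of the two averages share a translate of a square of side
    n + 1 - K, with K = p + p' + q + q', on which their point masses cancel.  Each
    average has mass 1, so the difference has mass at most
    2 - 2 (n + 1 - K)^2 / (n + 1)^2, which is below 4 K / (n + 1). *)
Lemma box_average_translate (g : garr G) p p' q q' n :
  (forall i j, gmul g (arrow (i + p) (j + q) (gsrc g)) =
    arrow (i + p') (j + q') (grng g)) ->
  (\esum_(h in grng @^-1` [set grng g])
    (`|box_average n (gsrc g) (gmul (ginv g) h) - box_average n (grng g) h|)%:E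
    <= (4 * (p + p' + q + q')%:R / n.+1%:R)%:E)%E.
Proof.
move=> gp; set K := (p + p' + q + q')%N; set m := (n.+1 - K)%N.
set c : R := n.+1%:R ^- 2; set D := grng @^-1` _.
have c0 : 0 <= c by rewrite invr_ge0 exprn_ge0.
pose u i j := gmul g (arrow i j (gsrc g)); pose v i j := arrow i j (grng g).
pose box k (w : nat -> nat -> garr G) h : R :=
  \sum_(0 <= i < k) \sum_(0 <= j < k) (h == w i j)%:R.
pose core h := box m (fun i j => v (i + p') (j + q'))%N h.
have Du i j : D (u i j) by rewrite /D /= grng_mul ?rng_arrow.
have Dv i j : D (v i j) by exact: rng_arrow.
have Eavg h : D h -> box_average n (gsrc g) (gmul (ginv g) h) = c * box n.+1 u h.
  move=> Dh; congr (_ * _); apply: eq_bigr => i _; apply: eq_bigr => j _.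
  by rewrite gmul_eq ?rng_arrow.
have box_ge0 k w h : 0 <= box k w h.
  by rewrite sumr_ge0// => i _; rewrite sumr_ge0.
have core_le r r' w h : (r <= K)%N -> (r' <= K)%N ->
    (forall i j, w (i + r)%N (j + r')%N = v (i + p')%N (j + q')%N) ->
    core h <= box n.+1 w h.
  move=> rK r'K wv; have [Kn|nK] := leqP K n.+1; last first.
    have m0 : m = 0%N by rewrite /m; lia.
    by rewrite /core {1}/box m0 big_nil.
  rewrite /core /box; under eq_bigr do under eq_bigr do rewrite -wv.
  by apply: (box_shift_le (F := fun i j => (h == w i j)%:R)) => //; rewrite /m; lia.
have core_u h : core h <= box n.+1 u h.
  by apply: (core_le p q) => //; rewrite /K; lia.
have core_v h : core h <= box n.+1 v h.
  by apply: (core_le p' q') => //; rewrite /K; lia.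
set X := \esum_(h in D) _.
(* Pointwise |s - t| + 2 r <= s + t whenever r <= s and r <= t; writing the
   inequality without subtraction keeps all the infinite sums nonnegative. *)
have H : (X + (2 * c * m%:R ^+ 2)%:E <= 2%:E)%E.
  have -> : (2 * c * m%:R ^+ 2)%:E = \esum_(h in D) (2 * c * core h)%:E.
    rewrite (@esum_box _ _ _ (cst (2 * c))) ?sum_box_cst 1?mulrC//.
    by move=> t; rewrite mulr_ge0.
  rewrite -esumD; last 2 first.
  - by move=> h _; rewrite lee_fin.
  - by move=> h _; rewrite lee_fin !mulr_ge0// box_ge0.
  have -> : 2%:E = \esum_(h in D) (c * box n.+1 u h + c * box n.+1 v h)%:E.
    under eq_esum do rewrite EFinD.
    rewrite esumD => [|h _|h _]; last 2 first.
    - by rewrite lee_fin mulr_ge0// box_ge0.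
    - by rewrite lee_fin mulr_ge0// box_ge0.
    by rewrite !(@esum_box _ _ _ (cst c))// !sum_box_cst -EFinD mulfV ?expf_neq0.
  apply: le_esum => h Dh; rewrite -EFinD lee_fin Eavg//.
  have : c * core h <= c * box n.+1 u h by rewrite ler_wpM2l.
  have : c * core h <= c * box n.+1 v h by rewrite ler_wpM2l.
  rewrite /box_average -/c -/(box n.+1 v h).
  by case: ler0P; lra.
have {}H : (X <= (2 - 2 * c * m%:R ^+ 2)%:E)%E.
  by rewrite EFinB leeBrDr.
apply: le_trans H _; rewrite lee_fin.
have N0 : (0 : R) < n.+1%:R by [].
have mN : n.+1%:R - K%:R <= m%:R :> R.
  by rewrite lerBlDr -natrD ler_nat /m; lia.
have m0 : 0 <= m%:R :> R by [].
have K0 : 0 <= K%:R :> R by [].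
rewrite /c; move: N0 mN m0 K0; move: (n.+1%:R) (m%:R) (K%:R) => N M L N0 mN m0 K0.
rewrite ler_pdivlMr//.
have -> : (2 - 2 * N ^- 2 * M ^+ 2) * N = (2 * N ^+ 2 - 2 * M ^+ 2) / N.
  by field; rewrite gt_eqF.
rewrite ler_pdivrMr//; have [LN|NL] := leP L N; first by nra.
nra.
Qed.

(** Averages over growing squares form an approximate invariant mean as soon as
    translation by any element of the groupoid acts on the family of arrows by a
    shift of indices. *)
Lemma borel_amenable_of_arrows : @second_countable (garr G) -> etale G ->
  (forall i j (f : garr G -> R), borel_function f ->
    borel_function (f \o arrow i j)) ->
  (forall g : garr G, exists p p' q q', forall i j,
    gmul g (arrow (i + p) (j + q) (gsrc g)) = arrow (i + p') (j + q') (grng g)) ->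
  borel_amenable R G.
Proof.
move=> sG eG bp inv; split=> //; exists box_average; split.
- by move=> n x g _; exact: box_average_ge0.
- exact: box_average_total.
- move=> n f _ bf.
  under eq_fun do rewrite asum_box_average.
  apply: borel_functionZ; apply: borel_function_sum => i.
  by apply: borel_function_sum => j; exact: (bp i j f bf).
- move=> g; have [p [p' [q [q' gp]]]] := inv g.
  apply: (@squeeze_cvge _ _ _ _ (cst 0%E) _
    (fun n => (4 * (p + p' + q + q')%:R / n.+1%:R)%:E)).
  + apply: nearW => n; rewrite box_average_translate// andbT.
    by apply: esum_ge0 => h _; rewrite lee_fin.
  + exact: cvg_cst.
  + apply: cvg_EFin; first exact: nearW.
    rewrite -[X in _ --> X](mulr0 (4 * (p + p' + q + q')%:R)).
    by apply: cvgMl_tmp; exact: cvg_harmonic.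
Qed.

End BoxAverages.

(** * Borel sets and families of germs *)

Section BorelSets.
Variable X : topologicalType.
Local Notation borel := (<<s (@open X) >>).
Implicit Types A B : set X.

Lemma borel_open A : open A -> borel A.
Proof. exact: sub_sigma_algebra. Qed.

Lemma borelC A : borel A -> borel (~` A).
Proof. by rewrite -setTD; exact: sigma_algebraCD. Qed.

Lemma borel_closed A : closed A -> borel A.
Proof. by move=> cA; rewrite -(setCK A); exact: borelC (borel_open (closed_openC cA)). Qed.

(** A countable index set is enumerated by an injection to [nat]; the n-th term of
    the resulting sequence is empty when n is not in the image. *)
Lemma borel_bigcup I (D : set I) (F : I -> set X) : countable D ->
  (forall i, D i -> borel (F i)) -> borel (\bigcup_(i in D) F i).
Proof.
move=> /countable_injP[f fI] bF.
have -> : \bigcup_(i in D) F i = \bigcup_n \bigcup_(i in [set i | D i /\ f i = n]) F i.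
  apply/seteqP; split=> [x [i Di Fx]|x [n _ [i [Di _] Fx]]]; last by exists i.
  by exists (f i) => //; exists i.
apply: sigma_algebra_bigcup => n.
have [[i [Di fin]]|no] := pselect (exists i, D i /\ f i = n); last first.
  rewrite (_ : [set i | _] = set0) ?bigcup_set0; first exact: sigma_algebra0.
  by apply/seteqP; split=> // i ?; apply: no; exists i.
rewrite (_ : [set i | _] = [set i]) ?bigcup_set1; first exact: bF.
apply/seteqP; split=> [j [Dj fjn]|_ -> //].
by apply: fI; [exact: mem_set|exact: mem_set|rewrite fjn fin].
Qed.

Lemma borelI A B : borel A -> borel B -> borel (A `&` B).
Proof.
move=> bA bB; rewrite -(setCK (A `&` B)) setCI; apply: borelC.
rewrite -bigcup2E; apply: sigma_algebra_bigcup => -[|[|i]] /=;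
  by [exact: borelC|exact: sigma_algebra0].
Qed.

End BorelSets.

Lemma borel_preimage (X Y : topologicalType) (f : X -> Y) :
  (forall U, open U -> <<s open >> (f @^-1` U)) ->
  forall A, <<s open >> A -> <<s open >> (f @^-1` A).
Proof.
move=> fo; apply: smallest_sub => //; split=> /=.
- by rewrite preimage_set0; exact: sigma_algebra0.
- by move=> A bA; rewrite setTD preimage_setC; exact: borelC.
- by move=> F bF; rewrite preimage_bigcup; exact: sigma_algebra_bigcup.
Qed.

Lemma borel_preimage_continuous (X Y : topologicalType) (f : X -> Y) :
  continuous f -> forall A, <<s open >> A -> <<s open >> (f @^-1` A).
Proof.
move=> fc; apply: borel_preimage => U oU; apply: borel_open.
by apply: open_comp => // x _; exact: fc.
Qed.

Section GermArrows.
Variables (R : realType) (Gam : groupType) (X : topologicalType).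
Variables (a : group_action Gam X) (w : nat -> nat -> X -> Gam).

Definition germ_arrow i j x : germs a := germ a (w i j x) (a (w i j x)^-1%g x).

(** On each of the countably many Borel sets where [w i j] is constant, the arrow
    is a continuous function of its range. *)
Lemma germ_arrow_borel (f : germs a -> R) i j : countable [set: Gam] ->
  (forall h, <<s open >> [set x | w i j x = h]) ->
  borel_function f -> borel_function (f \o germ_arrow i j).
Proof.
move=> cG bw bf B mB; rewrite comp_preimage; apply: borel_preimage (bf B mB) => U oU.
pose c h x := germ a h (a h^-1%g x).
have -> : germ_arrow i j @^-1` U =
    \bigcup_(h in [set: Gam]) ([set x | w i j x = h] `&` c h @^-1` U).
  apply/seteqP; split=> [x Ux|x [h _ [/= <- //]]].
  by exists (w i j x).
apply: borel_bigcup => // h _; apply: borelI => //; apply: borel_open.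
apply: open_comp => // x _; apply: continuous_comp; first exact: act_continuous.
exact: germ_continuous.
Qed.

(** The criterion for averages of arrows, in terms of the group elements whose
    germs are the arrows: the shift condition compares germs at the common
    source. *)
Lemma germ_groupoid_borel_amenable : countable [set: Gam] ->
  hausdorff_space X -> @second_countable X ->
  (forall i j h, <<s open >> [set x | w i j x = h]) ->
  (forall g x, exists p p' q q', forall i j,
    germ a (g * w (i + p)%N (j + q)%N x)%g (a (w (i + p)%N (j + q)%N x)^-1%g x) =
    germ_arrow (i + p') (j + q') (a g x)) ->
  borel_amenable R (germ_groupoid a).
Proof.
move=> cG hX sX bw inv.
apply: (@borel_amenable_of_arrows R (germ_groupoid a) germ_arrow).
- by move=> i j x /=; rewrite germ_rngE actKV.
- exact: germs_second_countable.
- exact: germ_groupoid_etale.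
- by move=> i j f; exact: germ_arrow_borel.
- elim/germP => g x; have [p [p' [q [q' H]]]] := inv g x.
  exists p, p', q, q' => i j /=; rewrite germ_srcE germ_rngE -H /germ_arrow.
  by rewrite -{1}(actKV a (w (i + p)%N (j + q)%N x) x) germ_mulE.
Qed.

End GermArrows.

(** * The circle as a Borel space *)

Section Circle.
Variable R : realType.
Implicit Types (x y z : circle R) (t : R).

Lemma circle_ge0 x : 0 <= val x. Proof. by case/andP: (valP x). Qed.
Lemma circle_lt1 x : val x < 1. Proof. by case/andP: (valP x). Qed.

Lemma circle_hausdorff : hausdorff_space (circle R).
Proof.
suff sep x y : val x < val y -> ~ cluster (nbhs x) y.
  move=> x y xy; apply: val_inj; apply/eqP; rewrite eq_le !leNgt.
  apply/andP; split; apply/negP => lt; apply: (sep _ _ lt) => //.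
  by move=> A B nA nB; rewrite setIC; exact: xy.
move=> xy; have y1 := circle_lt1 y; have x0 := circle_ge0 x.
have [e [e0 e1 e2 _]] : exists e, [/\ 0 < e, e < (val y - val x) / 2,
    e < (1 - val y) / 2 & e < 1].
  by apply: pos_below3 => //; rewrite divr_gt0// subr_gt0.
pose N z := [set u : circle R | `|val u - val z| < e \/ val z = 0 /\ 1 - e < val u].
have nN z : nbhs z (N z) by apply/nbhs_circleP; exists e.
move=> /(_ (N x) (N y) (nN x) (nN y))[u [ux uy]].
have near z : N z u -> (val z - e < val u < val z + e) \/ val z = 0 /\ 1 - e < val u.
  by move=> [|?]; [rewrite ltr_distl; left|right].
by case: (near x ux) => [/andP[? ?]|[? ?]]; case: (near y uy) => [/andP[? ?]|[? ?]]; lra.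
Qed.

Lemma circle_borel1 x : <<s open >> [set x].
Proof.
apply: borel_closed; apply: accessible_closed_set1.
by apply: hausdorff_accessible; exact: circle_hausdorff.
Qed.

(** Arcs avoiding 0 and arcs around 0: with rational end points they form a
    countable basis of the topology. *)
Definition arc (q r : R) := [set x : circle R | q < val x < r].
Definition coarc (q r : R) := [set x : circle R | val x < q \/ r < val x].

Lemma arc_open q r : 0 <= q -> open (arc q r).
Proof.
move=> q0; rewrite openE => x /andP[qx xr]; apply/nbhs_circleP.
have [e [e0 e1 e2 _]] : exists e, [/\ 0 < e, e < val x - q, e < r - val x & e < 1].
  by apply: pos_below3; rewrite ?subr_gt0.
exists e => // y; rewrite ltr_distl => -[/andP[? ?]|[? ?]]; last by lra.
by apply/andP; split; lra.
Qed.

Lemma coarc_open q r : 0 < q -> r < 1 -> open (coarc q r).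
Proof.
move=> q0 r1; rewrite openE => x xqr; apply/nbhs_circleP.
have [x0|x0] := eqVneq (val x) 0.
  exists (Num.min q (1 - r)); first by rewrite lt_min q0 subr_gt0.
  move=> y [|[_]]; rewrite ?x0 ?subr0 ?lt_min.
    by move=> /andP[+ _]; rewrite ltr_norml => /andP[_ ?]; left.
  by rewrite ltrBlDr -ltrBlDl lt_min => /andP[_ ?]; right; lra.
have {}x0 : 0 < val x by rewrite lt_def x0 circle_ge0.
case: xqr => xq.
  exists (q - val x); rewrite ?subr_gt0// => y [|[]]; last by lra.
  by rewrite ltr_distl => /andP[_ ?]; left; lra.
exists (val x - r); rewrite ?subr_gt0// => y [|[]]; last by lra.
by rewrite ltr_distl => /andP[? _]; right; lra.
Qed.

Lemma rat_between (s t : R) : s < t -> exists q : rat, s < ratr q < t.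
Proof. by move=> /rat_in_itvoo[q]; rewrite in_itv; exists q. Qed.

Lemma circle_second_countable : @second_countable (circle R).
Proof.
pose good (i : bool * (rat * rat)) := if i.1 then 0 <= (ratr i.2.1 : R) else
  (0 < (ratr i.2.1 : R)) && ((ratr i.2.2 : R) < 1).
pose F (i : bool * (rat * rat)) :=
  (if i.1 then arc else coarc) (ratr i.2.1) (ratr i.2.2).
exists [set F i | i in [set i | good i]].
  by apply: sub_countable (countableP [set i | good i]); exact: card_image_le.
split=> [_ [[[] [q r]] /= Hg <-]|x A].
- exact: arc_open.
- by case/andP: Hg => ? ?; exact: coarc_open.
move=> /nbhs_circleP[e e0 eA]; have x1 := circle_lt1 x.
have [x0|x0] := eqVneq (val x) 0.
  have /rat_between[q /andP[q0]] : 0 < Num.min e (1 / 2) by rewrite lt_min e0; lra.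
  have /rat_between[r /andP[+ r1]] : Num.max (1 - e) (1 / 2) < 1.
    by rewrite gt_max; apply/andP; split; lra.
  rewrite gt_max lt_min => /andP[? ?] /andP[? ?].
  exists (coarc (ratr q) (ratr r)).
    by split; [exists (false, (q, r)) => //; apply/andP|left; rewrite x0].
  move=> y [yq|yr]; apply: eA; [left|right].
    by rewrite x0 subr0 ger0_norm ?circle_ge0//; lra.
  by split=> //; lra.
have {}x0 : 0 < val x by rewrite lt_def x0 circle_ge0.
have /rat_between[q /andP[+ qx]] : Num.max (val x - e) 0 < val x.
  by rewrite gt_max x0 andbT; lra.
have /rat_between[r /andP[xr ?]] : val x < val x + e by lra.
rewrite gt_max => /andP[? ?].
exists (arc (ratr q) (ratr r)).
  by split; [exists (true, (q, r)) => //; exact: ltW|apply/andP].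
by move=> y /andP[? ?]; apply: eA; left; rewrite ltr_distl; apply/andP; split; lra.
Qed.

Lemma circle_borel_lt t : <<s open >> [set x : circle R | val x < t].
Proof.
have [t0|t0] := leP t 0.
  rewrite (_ : mkset _ = set0); first exact: sigma_algebra0.
  apply/seteqP; split=> // x xt.
  by have := lt_le_trans (xt : val x < t) t0; rewrite ltNge circle_ge0.
have [z z0] : exists x : circle R, val x = 0 by apply: circle_ex; rewrite lexx ltr01.
rewrite (_ : mkset _ = ~` (~` [set z] `&` ~` arc 0 t)).
  apply: borelC; apply: borelI; apply: borelC; first exact: circle_borel1.
  by apply: borel_open; exact: arc_open.
rewrite setCI !setCK; apply/seteqP; split=> x.
  move=> xt; have := circle_ge0 x; rewrite le_eqVlt => /predU1P[x0|x0].
    by left; apply: val_inj; rewrite -x0 z0.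
  by right; apply/andP.
by move=> [->|/andP[]//]; rewrite /mkset z0.
Qed.

(** The dyadic points form a countable set and points are closed. *)
Lemma dyadic_sub_borel (S : set (circle R)) :
  (forall x, S x -> dyadic (val x)) -> <<s open >> S.
Proof.
move=> Sd.
have -> : S = \bigcup_(p in [set: int * nat])
    (S `&` [set x : circle R | val x = p.1%:~R / 2 ^+ p.2]).
  apply/seteqP; split=> [x Sx|x [? _ []//]].
  by have [k [n e]] := Sd x Sx; exists (k, n).
apply: borel_bigcup => // -[k n] _.
have [[y [Sy yE]]|no] :=
  pselect (exists y, S y /\ val y = (k, n).1%:~R / 2 ^+ (k, n).2).
  rewrite (_ : _ `&` _ = [set y]); first exact: circle_borel1.
  by apply/seteqP; split=> [x [_ xE]|_ ->//]; apply: val_inj; rewrite [LHS]xE yE.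
rewrite (_ : _ `&` _ = set0); first exact: sigma_algebra0.
by apply/seteqP; split=> // x [Sx xE]; apply: no; exists x.
Qed.

End Circle.

(** * Countability of Thompson's group T, rotations and a stretching element *)

Section CountableGroup.
Variable R : realType.

(** An entry ((u, v), (k, c)) stands for the affine piece t |-> 2^k t + c on
    [u, v[.  For an element of T all of u, v and c are dyadic, so finite lists
    of entries are enough, and there are countably many of them. *)
Definition piece : countType := (rat * rat * (int * rat))%type.

Definition piecewise_by (L : seq piece) (f : R -> R) :=
  (forall x : R, 0 <= x < 1 ->
    exists2 p, p \in L & ratr p.1.1 <= x < ratr p.1.2) /\
  (forall p, p \in L ->
    affine_on f (ratr p.1.1) (ratr p.1.2) p.2.1 (ratr p.2.2)).

Lemma piecewise_by_inj L f1 f2 : piecewise_by L f1 -> piecewise_by L f2 ->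
  forall x, 0 <= x < 1 -> f1 x = f2 x.
Proof.
move=> [cov L1] [_ L2] x /cov[p pL xp].
by rewrite (L1 p pL)// (L2 p pL).
Qed.

Lemma dyadic_rational (x : R) : dyadic x -> exists q : rat, x = ratr q.
Proof.
move=> [k [n ->]]; exists (k%:~R / 2 ^+ n).
by rewrite rmorphM fmorphV rmorph_int rmorphXn rmorph_nat.
Qed.

(** Break points are dyadic and so are their images, hence so is the constant
    term. *)
Lemma affine_dyadic (f h : R -> R) s u v k c : inverse01 f h ->
  piecewise_pow2 f s -> (forall t, t \in s -> dyadic t) ->
  0 <= u < 1 -> u \in 0 :: s -> u < v -> affine_on f u v k c -> dyadic c.
Proof.
move=> fh fs ds u01 us uv fE.
have -> : c = f u - 2 ^ k * u by rewrite fE ?lexx// addrC addKr.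
apply: dyadicB; first exact: (dyadic_break fh fs ds u01 us).
apply: dyadicM; first exact: dyadic_pow2.
by move: us; rewrite inE => /predU1P[->|/ds//]; exact: dyadic0.
Qed.

Lemma piecewise_byP (f h : R -> R) s : inverse01 f h -> piecewise_pow2 f s ->
  (forall t, t \in s -> dyadic t) -> exists L, piecewise_by L f.
Proof.
move=> fh fs ds.
have piece_from u : 0 <= u < 1 -> u \in 0 :: s -> exists p : piece,
    [/\ u = ratr p.1.1, ratr p.1.2 \in 1 :: s, u < ratr p.1.2 :> R &
      affine_on f (ratr p.1.1) (ratr p.1.2) p.2.1 (ratr p.2.2)].
  move=> u01 us; have /andP[u0 u1] := u01.
  have [v [/andP[uv v1] vs fv]] := next_break s u1.
  have [k [c fE]] := fs u v u0 uv v1 fv.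
  have du : dyadic u by move: us; rewrite inE => /predU1P[->|/ds//]; exact: dyadic0.
  have dv : dyadic v by move: vs; rewrite inE => /predU1P[->|/ds//]; exact: dyadic1.
  have dc := affine_dyadic fh fs ds u01 us uv fE.
  have [q1 uE] := dyadic_rational du; have [q2 vE] := dyadic_rational dv.
  have [q3 cE] := dyadic_rational dc.
  by exists (q1, q2, (k, q3)); rewrite -uE -vE -cE.
have [L [L1 L2]] : exists L : seq piece,
    (forall u, u \in 0 :: s -> 0 <= u < 1 -> exists2 p, p \in L &
      [/\ u = ratr p.1.1, ratr p.1.2 \in 1 :: s & u < ratr p.1.2 :> R]) /\
    (forall p, p \in L ->
      affine_on f (ratr p.1.1) (ratr p.1.2) p.2.1 (ratr p.2.2)).
  move: piece_from; elim: (0 :: s) => [|u l IH] H; first by exists [::].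
  have [|L [L1 L2]] := IH.
    by move=> v v01 vl; apply: H => //; rewrite inE vl orbT.
  have [u01|u01] := boolP (0 <= u < 1); last first.
    exists L; split=> // v; rewrite inE => /predU1P[-> /(negP u01)//|]; exact: L1.
  have [p [p1 p2 p3 p4]] := H u u01 (mem_head _ _).
  exists (p :: L); split=> [v|r]; rewrite inE => /predU1P[->|].
  - by move=> _; exists p; [exact: mem_head|].
  - by move=> vl /(L1 v vl)[r rL ?]; exists r => //; rewrite inE rL orbT.
  - by [].
  - exact: L2.
exists L; split=> // x x01; have /andP[x0 x1] := x01.
have [xs|xs] := boolP (x \in 0 :: s).
  by have [p pL [xE _ xp]] := L1 x xs x01; exists p; rewrite // -xE lexx.
have {}x0 : 0 < x.
  by rewrite lt_def x0 andbT; apply: contra xs => /eqP->; exact: mem_head.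
have [u [/andP[u0 ux] us fu]] := prev_break s x0.
have [|p pL [uE vs up]] := L1 u us; first by rewrite u0 (lt_trans ux).
exists p => //; rewrite -uE (ltW ux) ltNge; apply/negP => px.
move: vs; rewrite inE => /predU1P[v1|vs]; first by move: px; rewrite v1 leNgt x1.
move: px; rewrite le_eqVlt => /predU1P[vx|vx].
  by move: xs; rewrite inE -vx vs orbT.
by apply: (fu _ vs); rewrite up.
Qed.

(** An element is determined by a finite list of affine pieces with rational
    data. *)
Lemma thompson_group_countable : countable [set: thompson_group R].
Proof.
have ex (g : thompson_group R) : exists L, piecewise_by L (unroll (val g)).
  have gV := thompsonT_V (thompsonP g); have [s ds gs] := thompsonV_piecewise gV.
  have [h gh hg] := thompsonV_bij gV.
  exact: piecewise_byP (unroll_inverse gh hg) gs ds.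
apply/countable_injP; exists (fun g => choice.pickle (projT1 (cid (ex g)))).
move=> g h _ _ /(pcan_inj choice.pickleK); case: cid => L Lg; case: cid => L' Lh.
move=> LL; have {LL} LL : L = L' := LL; rewrite -{}LL in Lh.
apply: val_inj; apply/funext => x.
apply: val_inj; rewrite -(unrollE (val g)) -(unrollE (val h)).
exact: (piecewise_by_inj Lg Lh (valP x)).
Qed.

End CountableGroup.

Section Elements.
Variable R : realType.
Implicit Types (f h : R -> R) (x y : circle R) (t d : R).

(** Builds elements of T from explicit functions on [0, 1). *)
Lemma thompson_lift f h s : inverse01 f h -> (forall t, t \in s -> dyadic t) ->
  piecewise_pow2 f s ->
  (forall t u, 0 <= t < 1 -> 0 <= u < 1 ->
    ~ continuous01 f t -> ~ continuous01 f u -> t = u) ->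
  exists g : thompson_group R, forall x, val (thompson_act g x) = f (val x).
Proof.
move=> fh ds fs dc; have [f01 [h01 fK]] := fh.
pose F x : circle R := Sub (f (val x)) (f01 _ (valP x)).
pose H x : circle R := Sub (h (val x)) (h01 _ (valP x)).
have FE x : val (F x) = f (val x) by exact: SubK.
have HE x : val (H x) = h (val x) by exact: SubK.
have bF : bijective F.
  exists H => x; apply: val_inj; rewrite ?HE ?FE ?HE.
    by have [] := fK _ (valP x).
  by have [] := fK _ (valP x).
have uF t : 0 <= t < 1 -> unroll F t = f t.
  by move=> /circle_ex[x <-]; rewrite unrollE FE.
have cF t : 0 <= t < 1 -> continuous01 f t -> continuous01 (unroll F) t.
  move=> t01 /continuous01P ft; apply/continuous01P => e /ft[d d0 dP].
  by exists d => // y y01; rewrite !uF//; exact: dP.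
have FT : thompsonT F.
  split.
    apply: (piecewise_thompsonV bF ds).
    by apply: eq_piecewise_pow2 fs => t t01; rewrite uF.
  by move=> t u t01 u01 ct cu; apply: dc => // [/(cF t t01)|/(cF u u01)].
by exists (thompson_of FT) => x; exact: FE.
Qed.

Lemma rotation_exists d : dyadic d -> 0 <= d < 1 -> exists g : thompson_group R,
  forall x, val (thompson_act g x) =
    if val x < 1 - d then val x + d else val x + d - 1.
Proof.
move=> dd /andP[d0 d1].
pose f t := if t < 1 - d then t + d else t + d - 1.
pose h t := if t < d then t - d + 1 else t - d.
have fh : inverse01 f h.
  split; first by move=> t /andP[t0 t1]; rewrite /f; case: ltP; lra.
  split; first by move=> t /andP[t0 t1]; rewrite /h; case: ltP; lra.
  move=> t /andP[t0 t1]; split; rewrite /f /h.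
    by case: (ltP t (1 - d)) => ?; case: ltP; lra.
  by case: (ltP t d) => ?; case: ltP; lra.
have fs : piecewise_pow2 f [:: 1 - d].
  move=> a b a0 ab b1 fr.
  have [ad|ad] := leP (1 - d) a.
    exists 0, (d - 1) => t /andP[at' tb]; rewrite /f expr0z; case: ltP; lra.
  have db : b <= 1 - d.
    by rewrite leNgt; apply/negP => ?; apply: (fr _ (mem_head _ _)); rewrite ad.
  by exists 0, d => t /andP[at' tb]; rewrite /f expr0z; case: ltP; lra.
apply: (thompson_lift fh _ fs) => [t|].
  by rewrite inE => /eqP->; apply: dyadicB => //; exact: dyadic1.
suff c t : 0 <= t < 1 -> ~ continuous01 f t -> t = 1 - d.
  by move=> t u t01 u01 /(c t t01)-> /(c u u01)->.
move=> t01 ct; apply: contrapT => td; apply: ct.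
apply: (continuous01_piecewise fs t01) => t0; have /andP[_ t1] := t01.
have [lt|gt|//] := ltgtP t (1 - d).
  exists 0, 0, d; split; rewrite ?lexx ?(ltW t1)//.
    by move=> u /andP[u0 ut]; rewrite /f expr0z; case: ltP; lra.
  by rewrite /f expr0z; case: ltP; lra.
exists (1 - d), 0, (d - 1); split; rewrite ?(ltW t1)//; first lra.
  by move=> u /andP[u0 ut]; rewrite /f expr0z; case: ltP; lra.
by rewrite /f expr0z; case: ltP; lra.
Qed.

Lemma quarter_dyadic n : dyadic (n%:R / 4 : R).
Proof. by exists n%:Z, 2%N; rewrite expr2; congr (_ / _); lra. Qed.

(** A standard generator of Thompson's group F: slope 2 on [0, 1/4[, slope 1 on
    [1/4, 1/2[ and slope 1/2 on [1/2, 1[.  With rotations it produces the local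
    doublings as well as all the germs at 0. *)
Lemma stretch_exists : exists g : thompson_group R,
  forall x, val (thompson_act g x) =
    if val x < 1 / 4 then 2 * val x
    else if val x < 1 / 2 then val x + 1 / 4 else (val x + 1) / 2.
Proof.
pose f t : R := if t < 1 / 4 then 2 * t
  else if t < 1 / 2 then t + 1 / 4 else (t + 1) / 2.
pose h t : R := if t < 1 / 2 then t / 2
  else if t < 3 / 4 then t - 1 / 4 else 2 * t - 1.
have fh : inverse01 f h.
  split; first by move=> t /andP[t0 t1]; rewrite /f; case: ltP => ?; [|case: ltP => ?]; lra.
  split; first by move=> t /andP[t0 t1]; rewrite /h; case: ltP => ?; [|case: ltP => ?]; lra.
  move=> t /andP[t0 t1]; split; rewrite /f /h.
    case: (ltP t (1 / 4)) => ?; [|case: (ltP t (1 / 2)) => ?];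
    by case: ltP => ?; [|case: ltP => ?]; lra.
  case: (ltP t (1 / 2)) => ?; [|case: (ltP t (3 / 4)) => ?];
  by case: ltP => ?; [|case: ltP => ?]; lra.
have f1 t : 0 <= t < 1 / 4 -> f t = 2 ^ (1 : int) * t + 0.
  by rewrite expr1z /f => ?; case: ltP; lra.
have f2 t : 1 / 4 <= t < 1 / 2 -> f t = 2 ^ (0 : int) * t + 1 / 4.
  by rewrite expr0z /f => ?; case: ltP => ?; [|case: ltP]; lra.
have f3 t : 1 / 2 <= t < 1 -> f t = 2 ^ (- 1 : int) * t + 1 / 2.
  by rewrite exprN1 /f => ?; case: ltP => ?; [|case: ltP]; lra.
have fs : piecewise_pow2 f [:: 1 / 4; 1 / 2].
  move=> a b a0 ab b1 fr.
  have [a1|a1] := ltP a (1 / 4).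
    have db : b <= 1 / 4.
      by rewrite leNgt; apply/negP => ?; apply: (fr (1 / 4)); rewrite ?inE ?eqxx// a1.
    by exists 1, 0 => t /andP[? ?]; apply: f1; lra.
  have [a2|a2] := ltP a (1 / 2).
    have db : b <= 1 / 2.
      rewrite leNgt; apply/negP => ?.
      by apply: (fr (1 / 2)); rewrite ?inE ?eqxx ?orbT// a2.
    by exists 0, (1 / 4) => t /andP[? ?]; apply: f2; lra.
  by exists (-1), (1 / 2) => t /andP[? ?]; apply: f3; lra.
apply: (thompson_lift fh _ fs) => [t|].
  rewrite !inE => /orP[/eqP->|/eqP->]; first exact: (quarter_dyadic 1).
  by rewrite (_ : 1 / 2 = 2%:R / 4); [exact: quarter_dyadic|lra].
suff c t : 0 <= t < 1 -> continuous01 f t by move=> t u /c ct _ /(_ ct).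
move=> t01; apply: (continuous01_piecewise fs t01) => t0; have /andP[_ t1] := t01.
have [t2|t2] := leP t (1 / 4).
  exists 0, 1, 0; split; [lra|lra| |].
    by move=> u ?; apply: f1; lra.
  move: t2; rewrite le_eqVlt => /predU1P[->|t2]; last by apply: f1; lra.
  by rewrite expr1z f2 ?expr0z; lra.
have [t3|t3] := leP t (1 / 2).
  exists (1 / 4), 0, (1 / 4); split; [lra|lra| |].
    by move=> u ?; apply: f2; lra.
  move: t3; rewrite le_eqVlt => /predU1P[->|t3]; last by apply: f2; lra.
  by rewrite expr0z f3 ?exprN1; lra.
exists (1 / 2), (-1), (1 / 2); split; [lra|lra| |].
  by move=> u ?; apply: f3; lra.
by apply: f3; lra.
Qed.

End Elements.

(** * Non-dyadic points: germs of the doubling map *)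

Section Congruence.
Variable R : realType.
Implicit Types s t u : R.

(** The angle coordinate of a point of the circle is well behaved only modulo 1;
    computing with congruences avoids following the wrap-around. *)
Definition eqmod1 s t := exists m : int, s - t = m%:~R.

Lemma eqmod1_refl t : eqmod1 t t.
Proof. by exists 0; rewrite subrr. Qed.

Lemma eqmod1_sym s t : eqmod1 s t -> eqmod1 t s.
Proof. by move=> [m e]; exists (- m); rewrite mulrNz -e opprB. Qed.

Lemma eqmod1_trans s t u : eqmod1 s t -> eqmod1 t u -> eqmod1 s u.
Proof. by move=> [m e] [n f]; exists (m + n); rewrite intrD -e -f; lra. Qed.

Lemma eqmod1D s t u : eqmod1 s t -> eqmod1 (s + u) (t + u).
Proof. by move=> [m e]; exists m; rewrite -e; lra. Qed.

Lemma eqmod1_pow2 n s t : eqmod1 s t -> eqmod1 (2 ^+ n * s) (2 ^+ n * t).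
Proof.
by move=> [m e]; exists (2 ^+ n * m); rewrite intrM -e rmorphXn mulrBr.
Qed.

Lemma eqmod1_eq s t : 0 <= s < 1 -> 0 <= t < 1 -> eqmod1 s t -> s = t.
Proof.
move=> s01 t01 [m e]; apply/eqP; rewrite -subr_eq0 e.
have : (-1)%:~R < m%:~R :> R by rewrite -e mulrNz; lra.
have : m%:~R < 1%:~R :> R by rewrite -e; lra.
by rewrite !ltr_int intr_eq0 => ? ?; apply/eqP; lia.
Qed.

Lemma circle_eqmod1 (x y : circle R) : eqmod1 (val x) (val y) -> x = y.
Proof. by move=> e; apply: val_inj; exact: (eqmod1_eq (valP x) (valP y) e). Qed.

End Congruence.

Section Doubling.
Variable R : realType.
Implicit Types (x y : circle R) (t d : R) (g h : thompson_group R).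
Local Notation act := (act (thompson_action R)).

Definition rotation_spec d g := forall x, val (act g x) =
  if val x < 1 - d then val x + d else val x + d - 1.

(** Total in [d] so that it can be applied to any coordinate; the value is 1 when
    no element of T is the rotation by [d]. *)
Definition rotation d : thompson_group R :=
  if pselect (exists g, rotation_spec d g) is left e then projT1 (cid e) else 1%g.

Definition stretch : thompson_group R := projT1 (cid (stretch_exists R)).

Lemma rotationE d x : dyadic d -> 0 <= d < 1 -> val (act (rotation d) x) =
  if val x < 1 - d then val x + d else val x + d - 1.
Proof.
move=> dd d01; rewrite /rotation; case: pselect => [e|]; first by case: cid.
by case; exact: rotation_exists.
Qed.

Lemma rotation_eqmod1 d x : dyadic d -> 0 <= d < 1 ->
  eqmod1 (val (act (rotation d) x)) (val x + d).
Proof.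
move=> dd d01; rewrite rotationE//; case: ltP => _; first exact: eqmod1_refl.
by exists (-1); rewrite mulrN1z; lra.
Qed.

Lemma rotationV_eqmod1 d x : dyadic d -> 0 <= d < 1 ->
  eqmod1 (val (act (rotation d)^-1%g x)) (val x - d).
Proof.
move=> dd d01; have := rotation_eqmod1 (act (rotation d)^-1%g x) dd d01.
rewrite actKV => /eqmod1_sym/(eqmod1D (- d)).
by rewrite addrK.
Qed.

Lemma stretchE x : val (act stretch x) =
  if val x < 1 / 4 then 2 * val x
  else if val x < 1 / 2 then val x + 1 / 4 else (val x + 1) / 2.
Proof. exact: (projT2 (cid (stretch_exists R)) x). Qed.

(** Rotate the arc [d, d + 1/4[ to the origin, double it there, and rotate the
    result by 2 d: in total t |-> 2 (t - d) + 2 d. *)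
Definition doubler d : thompson_group R :=
  (rotation d * (rotation d * (stretch * (rotation d)^-1)))%g.

Lemma doubler_eqmod1 d x : dyadic d -> 0 <= d < 1 -> d <= val x < d + 1 / 4 ->
  eqmod1 (val (act (doubler d) x)) (2 * val x).
Proof.
move=> dd d01 xd; rewrite /doubler !actM.
have yE : val (act (rotation d)^-1%g x) = val x - d.
  apply: (eqmod1_eq (valP (act (rotation d)^-1%g x)) _ (rotationV_eqmod1 x dd d01)).
  by have := circle_lt1 x; lra.
have sE : val (act stretch (act (rotation d)^-1%g x)) = 2 * val x - d - d.
  by rewrite stretchE yE; case: ltP; lra.
apply: eqmod1_trans (rotation_eqmod1 _ dd d01) _.
rewrite -[X in eqmod1 _ X](subrK d); apply: eqmod1D.
apply: eqmod1_trans (rotation_eqmod1 _ dd d01) _.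
by rewrite sE subrK; exact: eqmod1_refl.
Qed.

Definition quarter t : R := if t < 1 / 4 then 0
  else if t < 1 / 2 then 1 / 4 else if t < 3 / 4 then 1 / 2 else 3 / 4.

Lemma quarter_dyadic_lt1 t : dyadic (quarter t) /\ 0 <= quarter t < 1.
Proof.
have q n : dyadic (n%:R / 4 : R) by exact: quarter_dyadic.
rewrite /quarter; case: ltP => _; last case: ltP => _; last case: ltP => _.
- by split; [exact: dyadic0|lra].
- by split; [exact: (q 1)|lra].
- by split; [rewrite (_ : 1 / 2 = 2%:R / 4); [exact: q|lra]|lra].
- by split; [exact: (q 3)|lra].
Qed.

Lemma quarter_bounds t : 0 <= t < 1 -> quarter t <= t < quarter t + 1 / 4.
Proof.
by move=> t01; rewrite /quarter; case: ltP => ?; [|case: ltP => ?; [|case: ltP => ?]]; lra.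
Qed.

Lemma quarter_eq s t : 0 <= t < 1 -> quarter s <= t < quarter s + 1 / 4 ->
  quarter t = quarter s.
Proof.
move=> t01; rewrite /quarter.
case: (ltP s (1 / 4)) => ?; [|case: (ltP s (1 / 2)) => ?; [|case: (ltP s (3 / 4)) => ?]];
by move=> ?; case: ltP => ?; [|case: ltP => ?; [|case: ltP => ?]]; lra.
Qed.

Definition double_at x := doubler (quarter (val x)).

(** The element of T, chosen along the itinerary of [x] through the four quarters,
    whose germ at [x] is the i-fold doubling map. *)
Fixpoint expand i x : thompson_group R :=
  if i is i'.+1 then (expand i' (act (double_at x) x) * double_at x)%g else 1%g.

Lemma act_dyadic g x : dyadic (val (act g x)) <-> dyadic (val x).
Proof.
have gV := thompsonT_V (thompsonP g).
have [s ds gs] := thompsonV_piecewise gV; have [h gh hg] := thompsonV_bij gV.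
have := dyadic_piece (unroll_inverse gh hg) gs ds (valP x).
by rewrite (unrollE (val g)) => -[? ?]; split.
Qed.

Lemma circle_near x (e : R) (P : circle R -> Prop) : 0 < e -> 0 < val x ->
  (forall y, `|val y - val x| < e -> P y) -> \forall y \near x, P y.
Proof.
by move=> e0 x0 H; apply/nbhs_circleP; exists e => // y [/H//|[xz]]; lra.
Qed.

Lemma nondyadic_gt0 x : ~ dyadic (val x) -> 0 < val x.
Proof.
move=> nx; rewrite lt_def circle_ge0 andbT; apply/eqP => x0.
by apply: nx; rewrite x0; exact: dyadic0.
Qed.

(** A non-dyadic point is interior to its quarter, so nearby points are doubled by
    the same element. *)
Lemma quarter_near x : ~ dyadic (val x) ->
  \forall y \near x, quarter (val y) = quarter (val x).
Proof.
move=> nx; have [dq _] := quarter_dyadic_lt1 (val x).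
have /andP[qx xq] := quarter_bounds (valP x).
have x0 := nondyadic_gt0 nx.
have {}qx : quarter (val x) < val x.
  by rewrite lt_def qx andbT; apply/eqP => e; apply: nx; rewrite e.
have [e [e0 e1 e2 _]] : exists e, [/\ 0 < e, e < val x - quarter (val x),
    e < quarter (val x) + 1 / 4 - val x & e < 1].
  by apply: pos_below3; lra.
apply: (circle_near e0 x0) => y; rewrite ltr_distl => /andP[y1 y2].
by apply: quarter_eq; [exact: (valP y)|lra].
Qed.

Lemma expand_near i x : ~ dyadic (val x) ->
  \forall y \near x, eqmod1 (val (act (expand i x) y)) (2 ^+ i * val y).
Proof.
elim: i x => [|i IH] x nx.
  by apply: (filterE (F := nbhs x)) => y; rewrite expr0 mul1r; exact: eqmod1_refl.
have nDx : ~ dyadic (val (act (double_at x) x)) by move=> /act_dyadic.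
have nearD : \forall y \near x,
    eqmod1 (val (act (expand i (act (double_at x) x)) (act (double_at x) y)))
      (2 ^+ i * val (act (double_at x) y)).
  exact: (act_continuous (IH _ nDx)).
apply: (filterS2 (F := nbhs x)) nearD (quarter_near nx) => y H1 H2.
have [dq q01] := quarter_dyadic_lt1 (val x).
rewrite [expand _ _]/= actM; apply: eqmod1_trans H1 _.
rewrite exprSr -mulrA; apply: eqmod1_pow2.
by apply: doubler_eqmod1 => //; rewrite -H2; exact: (quarter_bounds (valP y)).
Qed.

Lemma affine_near g x : ~ dyadic (val x) -> exists (k : int) (c : R),
  dyadic c /\ \forall y \near x, val (act g y) = 2 ^ k * val y + c.
Proof.
move=> nx; have gV := thompsonT_V (thompsonP g).
have [s ds gs] := thompsonV_piecewise gV; have [h gh hg] := thompsonV_bij gV.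
have gi := unroll_inverse gh hg.
have x0 := nondyadic_gt0 nx.
have xs : val x \notin s by apply/negP => /ds.
have [|u [v [k [c [/andP[u0 ux] /andP[xv v1] us fE]]]]] := piece_around gs _ xs.
  by rewrite x0 circle_lt1.
have u01 : 0 <= u < 1 by rewrite u0 (lt_trans ux)// circle_lt1.
exists k, c; split.
  by apply: (affine_dyadic gi gs ds u01 us _ fE); exact: lt_trans xv.
have [e [e0 e1 e2 _]] : exists e, [/\ 0 < e, e < val x - u, e < v - val x & e < 1].
  by apply: pos_below3; lra.
apply: (circle_near e0 x0) => y; rewrite ltr_distl => /andP[y1 y2].
by rewrite -(fE (val y)) ?(unrollE (val g))//; lra.
Qed.

(** If g(t) = 2^k t + c near x, then 2^(i + p') (2^k t + c) and 2^(i + p) t are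
    congruent modulo 1 when p = p' + k and 2^p' c is an integer. *)
Lemma expand_translate g x : ~ dyadic (val x) -> exists p p', forall i,
  \forall y \near x, act (expand (i + p) x) y = act (expand (i + p') (act g x)) (act g y).
Proof.
move=> nx; have [k [c [[m [n cE]] gE]]] := affine_near g nx.
(* With c = m / 2^n, any p' >= n with p' + k >= 0 will do. *)
have [p [p' [pp' np']]] : exists p p' : nat,
    (2 : R) ^+ p = 2 ^+ p' * 2 ^ k /\ (n <= p')%N.
  case: k {gE} => l; last first.
    exists n, (n + l.+1)%N; split; last by rewrite leq_addr.
    by rewrite NegzE -exprnN exprD mulfK// expf_neq0.
  by exists (n + l)%N, n; rewrite exprD -exprnP.
exists p, p' => i.
have ngx : ~ dyadic (val (act g x)) by move=> /act_dyadic.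
have near1 : \forall y \near x,
    eqmod1 (val (act (expand (i + p') (act g x)) (act g y)))
      (2 ^+ (i + p') * val (act g y)).
  exact: (act_continuous (expand_near (i + p') ngx)).
near=> y; apply: circle_eqmod1.
apply: eqmod1_trans (_ : eqmod1 _ (2 ^+ (i + p) * val y)) _.
  by near: y; exact: expand_near.
apply/eqmod1_sym; apply: eqmod1_trans (_ : eqmod1 _ (2 ^+ (i + p') * val (act g y))) _.
  by near: y.
have -> : val (act g y) = 2 ^ k * val y + c by near: y.
exists (2 ^+ (i + (p' - n)) * m).
have e2 : (2 : R) ^+ p' = 2 ^+ (p' - n) * 2 ^+ n by rewrite -exprD subnK.
move: (val y) => t; rewrite intrM rmorphXn /= cE !exprD pp' e2.
by field; rewrite expf_neq0.
Unshelve. all: by end_near. Qed.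

(** The same identity read backwards along the doubling orbits: the arrows from
    the common point of the two orbits to x and to g x. *)
Lemma expand_germ g x : ~ dyadic (val x) -> exists p p', forall i,
  germ (thompson_action R) (g * (expand (i + p) x)^-1)%g (act (expand (i + p) x) x) =
  germ (thompson_action R) (expand (i + p') (act g x))^-1%g
    (act (expand (i + p') (act g x)) (act g x)).
Proof.
move=> nx; have [p [p' H]] := expand_translate g nx; exists p, p' => i.
have near_x := H i; have xE := nbhs_singleton near_x.
apply/germ_eq; split=> //.
set E := expand (i + p) x in near_x xE *; set E' := expand _ _ in near_x xE *.
have nearE : \forall y \near act E^-1%g (act E x), act E y = act E' (act g y).
  by rewrite actVK.
have {nearE} : \forall y \near act E x,
    act E (act E^-1%g y) = act E' (act g (act E^-1%g y)).
  exact: (act_continuous nearE).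
apply: (filterS (F := nbhs _)) => y /(congr1 (act E'^-1%g)).
rewrite actKV => ->.
by rewrite actM [RHS]actVK.
Qed.

Lemma expand_borel i h : <<s open >> [set x | expand i x = h].
Proof.
elim: i h => [|i IH] h.
  have [->|h1] := eqVneq h 1%g.
    rewrite (_ : mkset _ = setT); last by apply/seteqP.
    by apply: borel_open; exact: openT.
  rewrite (_ : mkset _ = set0); first exact: sigma_algebra0.
  by apply/seteqP; split=> // x /= e; move: h1; rewrite e eqxx.
(* The first digit takes four values, and fixing it leaves the preimage of a
   shorter itinerary under a continuous map. *)
pose D : set R := [set 0; 1 / 4; 1 / 2; 3 / 4].
have -> : [set x | expand i.+1 x = h] = \bigcup_(d in D)
    ([set x : circle R | quarter (val x) = d] `&`
     (act (doubler d) @^-1` [set x | expand i x = (h * (doubler d)^-1)%g])).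
  apply/seteqP; split=> [x xh|x [d _ [xd e]]].
    exists (quarter (val x)).
      rewrite /D /quarter; case: ltP => _; first by left; left; left.
      case: ltP => _; first by left; left; right.
      by case: ltP => _; [left|]; right.
    by split=> //=; rewrite -xh /= mulgK.
  by rewrite /mkset /= /double_at xd [expand _ _]e mulgVK.
apply: borel_bigcup => [|d _].
  by apply: finite_set_countable; rewrite /D !finite_setU.
apply: borelI; last first.
  apply: borel_preimage_continuous (IH _).
  exact: (@act_continuous _ _ (thompson_action R)).
have lt t : <<s open >> [set x : circle R | val x < t] by exact: circle_borel_lt.
have geq (s t : R) : <<s open >> [set x : circle R | s <= val x < t].
  have -> : [set x : circle R | s <= val x < t] =
      ~` [set x | val x < s] `&` [set x | val x < t].
    apply/seteqP; split=> [x /andP[sx xt]|x [/negP sx xt]].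
      by split=> //; apply/negP; rewrite -leNgt.
    by apply/andP; split=> //; rewrite leNgt.
  by apply: borelI => //; exact: borelC.
have [dq|dq] := pselect (exists x : circle R, quarter (val x) = d); last first.
  rewrite (_ : mkset _ = set0); first exact: sigma_algebra0.
  by apply/seteqP; split=> // x e; apply: dq; exists x.
rewrite (_ : mkset _ = [set x : circle R | d <= val x < d + 1 / 4]) //.
have [z <-] := dq; apply/seteqP; split=> x.
  by move=> <-; exact: (quarter_bounds (valP x)).
exact: (quarter_eq (valP x)).
Qed.

End Doubling.

(** * Dyadic points: the isotropy group at the origin *)

Section Origin.
Variable R : realType.
Implicit Types (x y : circle R) (t d : R) (g h : thompson_group R) (k l : int).
Local Notation act := (act (thompson_action R)).

Lemma zero_itv : 0 <= (0 : R) < 1. Proof. by rewrite lexx ltr01. Qed.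
Definition origin : circle R := Sub 0 zero_itv.

Lemma originE : val origin = 0. Proof. exact: SubK. Qed.

(** The germ of [g] at the origin, with left slope 2^k and right slope 2^l; points
    to the left of the origin have coordinates near 1. *)
Definition slopes g k l := exists2 e : R, 0 < e & forall y,
  (val y < e -> val (act g y) = 2 ^ l * val y) /\
  (1 - e < val y -> val (act g y) = 1 - 2 ^ k * (1 - val y)).

Lemma slopes_near g g' k l : slopes g k l -> slopes g' k l ->
  \forall y \near origin, act g y = act g' y.
Proof.
move=> [e e0 H] [e' e'0 H'].
have [d [d0 d1 d2 _]] : exists d, [/\ 0 < d, d < e, d < e' & d < 1].
  exact: pos_below3.
apply/nbhs_circleP; exists d => // y; rewrite originE subr0.
rewrite ger0_norm ?circle_ge0// => -[yd|[_ yd]]; apply: val_inj.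
  have [hy _] := H y; have [h'y _] := H' y.
  by rewrite hy ?h'y//; lra.
have [_ hy] := H y; have [_ h'y] := H' y.
by rewrite hy ?h'y//; lra.
Qed.

Lemma slopes1 : slopes 1%g 0 0.
Proof. by exists 1 => // y; rewrite expr0z act1; split; lra. Qed.

Lemma slopesM g h k l k' l' : slopes g k l -> slopes h k' l' ->
  slopes (g * h)%g (k + k') (l + l').
Proof.
move=> [e e0 H] [e' e'0 H'].
have := pow2_gt0 R k'; have := pow2_gt0 R l'.
set a := 2 ^ l'; set b := 2 ^ k' => a0 b0.
have [d [d0 d1 d2 d3]] : exists d, [/\ 0 < d, d < e', d < e / a & d < e / b].
  by apply: pos_below3; rewrite ?divr_gt0.
rewrite ltr_pdivlMr// in d2; rewrite ltr_pdivlMr// in d3.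
exists d => // y; rewrite actM; split=> yd.
  have [hy _] := H' y; have {}hy := hy ltac:(lra).
  have [gy _] := H (act h y); rewrite gy ?hy.
    by rewrite expfzDr// mulrA.
  by rewrite mulrC; apply: le_lt_trans d2; rewrite ler_pM2r// ltW.
have [_ hy] := H' y; have {}hy := hy ltac:(lra).
have [_ gy] := H (act h y); rewrite gy ?hy.
  by rewrite expfzDr//; ring.
rewrite ltrD2l ltrN2; apply: le_lt_trans d3.
by rewrite mulrC ler_pM2r//; lra.
Qed.

Lemma slopesX g k l n : slopes g k l -> slopes (g ^+ n)%g (k *+ n) (l *+ n).
Proof.
move=> H; elim: n => [|n IH]; first by rewrite expg0 !mulr0n; exact: slopes1.
by rewrite expgS !mulrS; exact: slopesM.
Qed.

(** To the left of 0 the continuity of [g] on the circle is what forces the limit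
    1 of its coordinate. *)
Lemma slopes_exist g : act g origin = origin -> exists k l, slopes g k l.
Proof.
move=> g0; have gT := thompsonP g; have gV := thompsonT_V gT.
have [s ds gs] := thompsonV_piecewise gV; have [h gh hg] := thompsonV_bij gV.
have gi := unroll_inverse gh hg.
have g00 : unroll (val g) 0 = 0.
  by rewrite -[X in unroll _ X]originE (unrollE (val g)) -[RHS]originE -{2}g0.
have [v [l [c [v0 v1 fE]]]] := piecewise_right gs zero_itv.
have c0 : c = 0 by move: g00; rewrite fE ?lexx// mulr0 add0r.
have [w ll] := left_lim_ex gs (ltac:(by rewrite ltr01 lexx) : 0 < (1 : R) <= 1).
have w1 : w = 1.
  have -> : w = Defs.wrap (unroll (val g) 0).
    by rewrite (left_lim_wrap gi gs (thompsonT_discontinuity gT) ll) /= eqxx.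
  by rewrite g00 /Defs.wrap eqxx.
have [u [k [c' [/andP[u0 u1] _ f'E wE]]]] := ll.
exists k, l; exists (Num.min v (1 - u)).
  by rewrite lt_min v0 subr_gt0.
move=> y; have [y0 y1] := (circle_ge0 y, circle_lt1 y).
rewrite -(unrollE (val g)) lt_min; split.
  by move=> /andP[yv _]; rewrite fE ?y0// c0 addr0.
rewrite ltrBDl -ltrBDr.
move=> yu; rewrite f'E; last first.
  rewrite y1 andbT; move: yu; rewrite ltrBlDr => yu.
  have : Num.min v (1 - u) <= 1 - u by rewrite ge_min lexx orbT.
  lra.
by move: wE; rewrite w1; lra.
Qed.

(** The isotropy group is generated by two elements that each change one of the
    two slopes; they use the break points 1/4 and 1/2 of [stretch], where only one
    of the adjacent slopes differs from 1. *)
Definition left_stretch : thompson_group R :=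
  (rotation (1 / 2) * (stretch R * rotation (1 / 4)))%g.

Definition right_shrink : thompson_group R :=
  (rotation (1 / 4) * (stretch R * rotation (1 / 2)))%g.

Lemma half_dyadic : dyadic (1 / 2 : R).
Proof. by rewrite (_ : 1 / 2 = 2%:R / 4); [exact: quarter_dyadic|lra]. Qed.

Lemma quarter1_dyadic : dyadic (1 / 4 : R).
Proof. exact: (quarter_dyadic R 1). Qed.

Lemma rotation_half y : val (act (rotation (1 / 2)) y) =
  if val y < 1 / 2 then val y + 1 / 2 else val y - 1 / 2.
Proof.
rewrite rotationE; [|exact: half_dyadic|lra].
by do 2![case: ltP => ?]; lra.
Qed.

Lemma rotation_quarter y : val (act (rotation (1 / 4)) y) =
  if val y < 3 / 4 then val y + 1 / 4 else val y - 3 / 4.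
Proof.
rewrite rotationE; [|exact: quarter1_dyadic|lra].
by do 2![case: ltP => ?]; lra.
Qed.

Lemma left_stretch_slopes : slopes left_stretch 1 0.
Proof.
exists (1 / 8) => [|y]; first lra.
have [y0 y1] := (circle_ge0 y, circle_lt1 y).
rewrite /left_stretch !actM rotation_half stretchE rotation_quarter.
rewrite expr1z expr0z; move: (val y) y0 y1 => t t0 t1; split=> td.
  have -> : (t < 3 / 4) = true by lra.
  have -> : (t + 1 / 4 < 1 / 4) = false by lra.
  have -> : (t + 1 / 4 < 1 / 2) = true by lra.
  have -> : (t + 1 / 4 + 1 / 4 < 1 / 2) = false by lra.
  lra.
have -> : (t < 3 / 4) = false by lra.
have -> : (t - 3 / 4 < 1 / 4) = true by lra.
have -> : (2 * (t - 3 / 4) < 1 / 2) = true by lra.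
lra.
Qed.

Lemma right_shrink_slopes : slopes right_shrink 0 (-1).
Proof.
exists (1 / 8) => [|y]; first lra.
have [y0 y1] := (circle_ge0 y, circle_lt1 y).
rewrite /right_shrink !actM rotation_quarter stretchE rotation_half.
rewrite exprN1 expr0z; move: (val y) y0 y1 => t t0 t1; split=> td.
  have -> : (t < 1 / 2) = true by lra.
  have -> : (t + 1 / 2 < 1 / 4) = false by lra.
  have -> : (t + 1 / 2 < 1 / 2) = false by lra.
  have -> : ((t + 1 / 2 + 1) / 2 < 3 / 4) = false by lra.
  lra.
have -> : (t < 1 / 2) = false by lra.
have -> : (t - 1 / 2 < 1 / 4) = false by lra.
have -> : (t - 1 / 2 < 1 / 2) = true by lra.
have -> : (t - 1 / 2 + 1 / 4 < 3 / 4) = true by lra.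
lra.
Qed.

Lemma slopes_origin g k l : slopes g k l -> act g origin = origin.
Proof.
move=> [e e0 H]; have [E _] := H origin; apply: val_inj.
by rewrite E originE ?mulr0.
Qed.

(** With nonnegative exponents only, these fill a quadrant of the isotropy group
    Z^2, which suffices because the averages are taken over squares in a
    quadrant. *)
Definition isotropy i j : thompson_group R :=
  (left_stretch ^+ i * right_shrink ^+ j)%g.

Lemma isotropy_slopes i j : slopes (isotropy i j) i%:Z (- j%:Z).
Proof.
have -> : i%:Z = 1 *+ i + 0 *+ j by rewrite mul0rn addr0 natz.
have -> : - j%:Z = 0 *+ i + (-1) *+ j.
  by rewrite mul0rn add0r mulNrn natz.
by apply: slopesM; apply: slopesX; [exact: left_stretch_slopes|exact: right_shrink_slopes].
Qed.

Lemma rotation_origin x : dyadic (val x) -> act (rotation (val x)) origin = x.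
Proof.
move=> dx; apply: circle_eqmod1.
have := rotation_eqmod1 origin dx (valP x).
by rewrite originE add0r.
Qed.

(** Conjugating [g] by the base arrows gives a germ at the origin, that is an
    element of Z^2, and it acts on the quadrant of isotropy elements by a shift. *)
Lemma isotropy_germ g x : dyadic (val x) -> exists p p' q q', forall i j,
  germ (thompson_action R) (g * (rotation (val x) * isotropy (i + p) (j + q)))%g origin =
  germ (thompson_action R)
    (rotation (val (act g x)) * isotropy (i + p') (j + q'))%g origin.
Proof.
move=> dx; have dgx : dyadic (val (act g x)) by apply/act_dyadic.
set r := rotation _; set r' := rotation _.
pose h := (r'^-1 * (g * r))%g.
have h0 : act h origin = origin.
  by rewrite /h !actM rotation_origin// -{1}(rotation_origin dgx) actVK.
have [k [l hkl]] := slopes_exist h0.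
(* Shifts by a negative integer are expressed by shifting the other side. *)
have split_int (m : int) : exists a b : nat, m = b%:Z - a%:Z.
  case: m => n; first by exists 0%N, n; rewrite subr0.
  by exists n.+1, 0%N; rewrite NegzE sub0r.
have [p [p' kE]] := split_int k; have [q' [q lE]] := split_int l.
exists p, p', q, q' => i j; apply/germ_eq; split=> //.
have := slopesM hkl (isotropy_slopes (i + p) (j + q)).
have -> : k + (i + p)%:Z = (i + p')%N by rewrite kE; lia.
have -> : l - (j + q)%:Z = - (j + q')%:Z by rewrite lE; lia.
move=> /slopes_near/(_ (isotropy_slopes _ _)).
apply: (filterS (F := nbhs _)) => y /(congr1 (act r')).
by rewrite /h !actM actKV.
Qed.

End Origin.

Theorem theorem3p3 (R : realType) :
  borel_amenable R (germ_groupoid (thompson_action R)).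
Proof.
pose w i j (x : circle R) : thompson_group R :=
  if `[< dyadic (val x) >] then (rotation (val x) * isotropy R i j)%g
  else (expand i x)^-1%g.
apply: (@germ_groupoid_borel_amenable R _ _ (thompson_action R) w).
- exact: thompson_group_countable.
- exact: circle_hausdorff.
- exact: circle_second_countable.
- move=> i j h; pose D := [set x : circle R | dyadic (val x)].
  have bD : <<s open >> D by exact: dyadic_sub_borel.
  have -> : [set x | w i j x = h] = ~` (~` ([set x | w i j x = h] `&` D) `&`
      ~` ([set x | expand i x = h^-1%g] `&` ~` D)).
    rewrite setCI !setCK; apply/seteqP; split=> x.
      rewrite /mkset => wx; have [Dx|Dx] := pselect (D x); [by left|right].
      by split=> //; move: wx; rewrite /mkset /w asboolF// => <-; rewrite invgK.
    by move=> [[]//|[e Dx]]; rewrite /mkset /w asboolF// e invgK.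
  apply: borelC; apply: borelI; apply: borelC.
    by apply: dyadic_sub_borel => x [].
  by apply: borelI; [exact: expand_borel|exact: borelC].
- move=> g x; have [dx|dx] := pselect (dyadic (val x)).
    have [p [p' [q [q' H]]]] := isotropy_germ g dx; exists p, p', q, q' => i j.
    have dgx : dyadic (val (act (thompson_action R) g x)) by apply/act_dyadic.
    have wV i' j' y : dyadic (val y) ->
        act (thompson_action R) (w i' j' y)^-1%g y = origin R.
      move=> dy; rewrite /w asboolT//.
      apply: (can_inj (actVK (thompson_action R) (rotation (val y) * isotropy R i' j')%g)).
      rewrite [LHS]actKV actM (slopes_origin (isotropy_slopes R i' j')).
      by rewrite rotation_origin.
    by rewrite /germ_arrow !wV// /w !asboolT.
have [p [p' H]] := expand_germ g dx; exists p, p', 0%N, 0%N => i j.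
have dgx : ~ dyadic (val (act (thompson_action R) g x)) by move=> /act_dyadic.
by rewrite /germ_arrow /w !asboolF// !invgK H.
Qed.
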